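(* Let $\alpha>0$ and $\beta\ge0$, and consider the planar system of ordinary differential equations $$\left\{\begin{aligned}\dot\lambda(t)&=2\beta\bigl(m(t)+\tanh(\lambda(t))\bigr)-\alpha\lambda(t),\\ \dot m(t)&=-2\bigl(m(t)+\tanh(\lambda(t))\bigr),\end{aligned}\right.$$ for $(m(t),\lambda(t))$ in the phase plane $\mathbb{R}^2$. (i) If $\beta\le\frac{\alpha}{2}+1$, then the origin $(0,0)$ is a global attractor for the system. (ii) If $\beta>\frac{\alpha}{2}+1$, then the system has a unique periodic orbit, and this orbit attracts all trajectories except the fixed point $(0,0)$.
   Context: The origin is a global attractor if every solution converges to $(0,0)$ as $t\to+\infty$. A periodic orbit means the orbit of a non-constant periodic solution. A periodic orbit attracts a trajectory if the distance of the trajectory at time $t$ from the orbit tends to $0$ as $t\to+\infty$. *)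

(* Defs.v *)
From Stdlib Require Import Reals.
From Coquelicot Require Import Coquelicot.

Open Scope R_scope.

(* Points of the phase plane are written (m, lambda), in this order. *)

Definition m_field (m lambda : R) : R :=
  - 2 * (m + tanh lambda).

Definition lambda_field (alpha beta m lambda : R) : R :=
  2 * beta * (m + tanh lambda) - alpha * lambda.

(* [D_in] is differentiability relative to [I], hence one-sided at an endpoint
   of an interval [I]. *)
Definition solution_on (I : R -> Prop) (alpha beta : R) (m lambda : R -> R) : Prop :=
  forall t : R, I t ->
    D_in lambda (fun s => lambda_field alpha beta (m s) (lambda s)) I t /\
    D_in m (fun s => m_field (m s) (lambda s)) I t.

(* The values of [m] and [lambda] at negative times are irrelevant. The system is
   autonomous, so taking 0 as the initial time is no restriction; its vector
   field is globally Lipschitz, so every solution extends to such a one. *)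
Definition trajectory (alpha beta : R) (m lambda : R -> R) : Prop :=
  solution_on (fun t => 0 <= t) alpha beta m lambda.

Definition origin_global_attractor (alpha beta : R) : Prop :=
  forall m lambda : R -> R, trajectory alpha beta m lambda ->
    is_lim m p_infty 0 /\ is_lim lambda p_infty 0.

Definition periodic_solution (alpha beta : R) (m lambda : R -> R) : Prop :=
  solution_on (fun _ => True) alpha beta m lambda /\
  exists T : R, 0 < T /\
    forall t : R, m (t + T) = m t /\ lambda (t + T) = lambda t.

Definition non_constant (m lambda : R -> R) : Prop :=
  exists s t : R, (m s, lambda s) <> (m t, lambda t).

Definition periodic_orbit (alpha beta : R) (G : R * R -> Prop) : Prop :=
  exists m lambda : R -> R,
    periodic_solution alpha beta m lambda /\
    non_constant m lambda /\
    forall p : R * R, G p <-> exists t : R, p = (m t, lambda t).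

(* The infimum of the Euclidean distances; [real] loses nothing for nonempty [G],
   while the empty set gets distance 0. *)
Definition dist_to_set (p : R * R) (G : R * R -> Prop) : R :=
  real (Glb_Rbar (fun d => exists q : R * R,
    G q /\ d = dist_euc (fst p) (snd p) (fst q) (snd q))).

Definition attracts (G : R * R -> Prop) (m lambda : R -> R) : Prop :=
  is_lim (fun t => dist_to_set (m t, lambda t) G) p_infty 0.

(* Main.v *)
Require Import Defs.
From Stdlib Require Import Reals ZArith Lra Lia Classical IndefiniteDescription.
From Coquelicot Require Import Coquelicot.

Open Scope R_scope.

(** With [x = lambda], [w = sqrt (2 alpha)] and [y = (w / alpha) (lambda + beta m)]
    the system becomes the Lienard system [x' = w y - F x], [y' = - w x] with
    [F x = (alpha + 2) x - 2 beta tanh x], and the energy [x^2 + y^2] has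
    derivative [- 2 x F x].

    If [beta <= alpha / 2 + 1], then [x F x] is positive away from 0. The energy
    decreases to a limit, so Barbalat's lemma ([barbalat]) gives [x F x -> 0], that
    is [lambda -> 0]; the equation [m' = - 2 m - 2 tanh lambda] then drives [m] to 0
    ([damped_lim]).

    If [beta > alpha / 2 + 1], then [F x / x] is still strictly increasing on
    [x > 0], because [tanh] is strictly concave there, but it is negative near 0. The
    energy of a nonzero solution stays away from 0 and from infinity, and another
    use of Barbalat's lemma shows that the solution meets the axis [x = 0] again
    and again ([crosses_axis]). Let [theta] be the angle measured clockwise from the
    positive [y] axis and [W = (x^2 + y^2) theta']. The identity
    [W' + F'(x) W = w x (x F'(x) - F x) >= 0] shows that from the first crossing on
    the solution turns clockwise for ever ([rotation_pos]), so that the logarithm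
    [e] of its radius is a function of the angle [s] ([polar_form]), with
    [de/ds = - f sin^2 s / (w - f sin s cos s)] where [f = F x / x].

    The right-hand side decreases strictly with [f], hence with [e], except on the
    axis [x = 0] ([slope_antitone]). So the distance of two such profiles never
    grows and their order never changes ([gap_nonincreasing], [profile_order]). Since
    the system is odd, a profile shifted by a half turn is again a profile;
    comparing the two makes the sequence [e (n pi)] monotone, and it is bounded,
    so it converges. The profile that starts from the limit is invariant under the
    half turn ([half_periodic_of_limit]): it is a limit cycle. Two half-turn
    invariant profiles coincide, as their distance would otherwise decrease strictly
    over a half turn ([half_periodic_unique]); hence all profiles have the same
    limit and approach the same cycle ([profile_attracted]). This yields existence,
    uniqueness and global attraction together ([lienard_limit_cycle]). *)

(** * One-variable calculus *)

(** [auto_derive] leaves derivatives of unknown functions behind; they are read off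
    the [is_derive] hypotheses, and the algebraic identity is left to the caller. *)
Ltac derive_from_context :=
  auto_derive;
  [ repeat split; try (eexists; eassumption)
  | repeat match goal with
    | H : is_derive ?f ?t ?d |- context [Derive ?g ?t] =>
        change (Derive g t) with (Derive f t); rewrite (is_derive_unique f t d H)
    end ].

Lemma is_lim_p_infty_eps (f : R -> R) (l : R) :
  is_lim f p_infty l <->
  (forall eps, 0 < eps -> exists T, forall t, T < t -> Rabs (f t - l) < eps).
Proof.
  split.
  - intros H eps He. apply is_lim_spec in H. destruct (H (mkposreal eps He)) as [T HT].
    exists T; exact HT.
  - intros H. apply is_lim_spec. intros eps. destruct (H eps (cond_pos eps)) as [T HT].
    exists T; exact HT.
Qed.

Lemma nonincreasing_of_derive (f df : R -> R) (a b : R) :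
  a <= b ->
  (forall t, a <= t <= b -> is_derive f t (df t)) ->
  (forall t, a <= t <= b -> df t <= 0) -> f b <= f a.
Proof.
  intros [Hab | ->] Hd Hs; [| lra].
  destruct (MVT_cor2 f df a b Hab) as (c & Hc & Hac).
  { intros c Hc. apply is_derive_Reals, Hd, Hc. }
  specialize (Hs c ltac:(lra)). nra.
Qed.

Lemma nondecreasing_of_derive (f df : R -> R) (a b : R) :
  a <= b ->
  (forall t, a <= t <= b -> is_derive f t (df t)) ->
  (forall t, a <= t <= b -> 0 <= df t) -> f a <= f b.
Proof.
  intros Hab Hd Hs.
  enough (- f b <= - f a) by lra.
  apply (nonincreasing_of_derive (fun t => - f t) (fun t => - df t)); auto.
  - intros t Ht. specialize (Hd t Ht). derive_from_context. ring.
  - intros t Ht. specialize (Hs t Ht). lra.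
Qed.

Lemma increasing_of_derive (f df : R -> R) (a b : R) :
  a < b ->
  (forall t, a <= t <= b -> is_derive f t (df t)) ->
  (forall t, a < t < b -> 0 < df t) -> f a < f b.
Proof.
  intros Hab Hd Hs.
  destruct (MVT_cor2 f df a b Hab) as (c & Hc & Hac).
  { intros c Hc. apply is_derive_Reals, Hd, Hc. }
  specialize (Hs c Hac). nra.
Qed.

Lemma constant_of_derive (f : R -> R) (a b : R) :
  (forall t, Rmin a b <= t <= Rmax a b -> is_derive f t 0) -> f a = f b.
Proof.
  intros Hd. destruct (MVT_gen f a b (fun _ => 0)) as (c & _ & Hc).
  - intros t Ht. apply Hd. lra.
  - intros t Ht. apply continuity_pt_filterlim, @ex_derive_continuous.
    eexists; apply Hd, Ht.
  - lra.
Qed.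

Lemma lipschitz_of_derive (f df : R -> R) (K a b : R) :
  a <= b ->
  (forall t, a <= t <= b -> is_derive f t (df t)) ->
  (forall t, a <= t <= b -> Rabs (df t) <= K) ->
  Rabs (f b - f a) <= K * (b - a).
Proof.
  intros [Hab | ->] Hd HK.
  2: { rewrite Rminus_diag, Rabs_R0. lra. }
  destruct (MVT_cor2 f df a b Hab) as (c & Hc & Hac).
  { intros c Hc. apply is_derive_Reals, Hd, Hc. }
  rewrite Hc, Rabs_mult, (Rabs_pos_eq (b - a)) by lra.
  apply Rmult_le_compat_r; [lra | apply HK; lra].
Qed.

(** Barbalat's lemma: on a window of fixed small length the mean value theorem
    makes [df] small somewhere, because [f] settles, and the bound on the
    derivative of [df] transports that smallness to the whole window. *)
Lemma barbalat (f df ddf : R -> R) (l K : R) :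
  (forall t, 0 <= t -> is_derive f t (df t)) ->
  (forall t, 0 <= t -> is_derive df t (ddf t)) ->
  (forall t, 0 <= t -> Rabs (ddf t) <= K) ->
  is_lim f p_infty l -> is_lim df p_infty 0.
Proof.
  intros Hf Hdf HK Hl. apply is_lim_p_infty_eps; intros eps Heps.
  assert (HK0 : 0 <= K).
  { specialize (HK 0 (Rle_refl 0)). pose proof (Rabs_pos (ddf 0)). lra. }
  set (d := eps / (2 * (K + 1))).
  assert (Hd : 0 < d) by (apply Rdiv_lt_0_compat; lra).
  assert (HKd : K * d <= eps / 2).
  { replace (eps / 2) with ((K + 1) * d) by (unfold d; field; lra). nra. }
  destruct (proj1 (is_lim_p_infty_eps f l) Hl (d * eps / 4)) as [T HT].
  { apply Rdiv_lt_0_compat; nra. }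
  exists (Rmax T 0); intros t Ht.
  assert (T < t) by (pose proof (Rmax_l T 0); lra).
  assert (0 <= t) by (pose proof (Rmax_r T 0); lra).
  destruct (MVT_cor2 f df t (t + d)) as (c & Hc & Htc); [lra | |].
  { intros c Hc. apply is_derive_Reals, Hf. lra. }
  assert (Hlip : Rabs (df c - df t) <= K * (c - t)).
  { apply (lipschitz_of_derive df ddf); intros; try apply Hdf; try apply HK; lra. }
  assert (H1 := HT t ltac:(lra)). assert (H2 := HT (t + d) ltac:(lra)).
  assert (Hdc : Rabs (df c * d) < d * eps / 2).
  { replace (df c * d) with ((f (t + d) - l) - (f t - l))
      by (replace (t + d - t) with d in Hc by ring; lra).
    eapply Rle_lt_trans; [apply Rabs_triang |]. rewrite Rabs_Ropp. lra. }
  rewrite Rabs_mult, (Rabs_pos_eq d) in Hdc by lra.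
  assert (Rabs (df c) < eps / 2) by nra.
  rewrite Rminus_0_r.
  replace (df t) with (df c - (df c - df t)) by ring.
  eapply Rle_lt_trans; [apply Rabs_triang |]. rewrite Rabs_Ropp. nra.
Qed.

Lemma nonincreasing_bounded_lim (f : R -> R) (b : R) :
  (forall s t, 0 <= s -> s <= t -> f t <= f s) ->
  (forall t, 0 <= t -> b <= f t) ->
  exists l : R, is_lim f p_infty l.
Proof.
  intros Hmon Hb.
  destruct (completeness (fun v => exists t, 0 <= t /\ v = - f t)) as [l [Hub Hleast]].
  - exists (- b). intros v (t & Ht & ->). specialize (Hb t Ht). lra.
  - exists (- f 0), 0. lra.
  - exists (- l). apply is_lim_p_infty_eps; intros eps Heps.
    assert (Hex : exists T, 0 <= T /\ l - eps < - f T).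
    { apply Classical_Prop.NNPP; intros Hn.
      assert (l <= l - eps); [| lra].
      apply Hleast. intros v (t & Ht & ->).
      apply Rnot_lt_le; intros Hlt. apply Hn. exists t; split; auto. }
    destruct Hex as (T & HT & HlT). exists T; intros t Ht.
    assert (- f t <= l) by (apply Hub; exists t; split; [lra | auto]).
    assert (f t <= f T) by (apply Hmon; lra).
    apply Rabs_def1; lra.
Qed.

(** A linear damped equation driven by a bounded force: after multiplication by
    [exp (c t)] the excess of [|f|] over [B / c] can only decrease. *)
Lemma damped_bound (f b : R -> R) (c B T t : R) :
  0 < c -> T <= t ->
  (forall s, T <= s -> is_derive f s (b s - c * f s)) ->
  (forall s, T <= s -> Rabs (b s) <= B) ->
  Rabs (f t) <= Rabs (f T) * exp (- c * (t - T)) + B / c.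
Proof.
  intros Hc HTt Hf Hb.
  assert (Hstep : forall g a : R -> R,
    (forall s, T <= s -> is_derive g s (a s - c * g s)) ->
    (forall s, T <= s -> a s <= B) ->
    g t <= g T * exp (- c * (t - T)) + B / c).
  { intros g a Hg Ha.
    assert (H : (g t - B / c) * exp (c * (t - T)) <= (g T - B / c) * exp (c * (T - T))).
    { apply (nonincreasing_of_derive (fun s => (g s - B / c) * exp (c * (s - T)))
               (fun s => (a s - B) * exp (c * (s - T)))); auto.
      - intros s Hs. specialize (Hg s (proj1 Hs)).
        derive_from_context. unfold Rminus. field. lra.
      - intros s Hs. specialize (Ha s (proj1 Hs)).
        pose proof (exp_pos (c * (s - T))). nra. }
    rewrite Rminus_diag, Rmult_0_r, exp_0, Rmult_1_r in H.
    replace (- c * (t - T)) with (- (c * (t - T))) by ring.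
    rewrite exp_Ropp. set (E := exp (c * (t - T))) in *.
    assert (HE : 1 <= E).
    { unfold E. rewrite <- exp_0. destruct (Rle_lt_or_eq_dec 0 (c * (t - T))) as [Hlt | <-].
      - apply Rmult_le_pos; lra.
      - left; apply exp_increasing; exact Hlt.
      - lra. }
    assert (HB : 0 <= B / c).
    { specialize (Hb T (Rle_refl T)). pose proof (Rabs_pos (b T)).
      apply Rdiv_le_0_compat; lra. }
    apply (Rmult_le_reg_r E); [lra |].
    rewrite Rmult_plus_distr_r, (Rmult_assoc (g T)), Rinv_l, Rmult_1_r by lra. nra. }
  assert (H1 := Hstep f b Hf (fun s Hs => proj2 (proj1 (Rabs_le_between _ _) (Hb s Hs)))).
  assert (H2 : - f t <= - f T * exp (- c * (t - T)) + B / c).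
  { apply (Hstep (fun s => - f s) (fun s => - b s)).
    - intros s Hs. specialize (Hf s Hs). derive_from_context. ring.
    - intros s Hs. pose proof (proj1 (proj1 (Rabs_le_between _ _) (Hb s Hs))). lra. }
  pose proof (exp_pos (- c * (t - T))).
  pose proof (Rle_abs (f T)). pose proof (Rle_abs (- f T)). rewrite Rabs_Ropp in *.
  apply Rabs_le; split; nra.
Qed.

(** From a time where the force is below [c eps / 2] on, [damped_bound] leaves
    [eps / 2] plus a transient that decays like [exp (- c t)]. *)
Lemma damped_lim (f b : R -> R) (c : R) :
  0 < c ->
  (forall s, 0 <= s -> is_derive f s (b s - c * f s)) ->
  is_lim b p_infty 0 -> is_lim f p_infty 0.
Proof.
  intros Hc Hf Hb. apply is_lim_p_infty_eps; intros eps Heps.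
  destruct (proj1 (is_lim_p_infty_eps b 0) Hb (c * eps / 2)) as [T0 HT0].
  { apply Rdiv_lt_0_compat; nra. }
  set (T := Rmax T0 0 + 1).
  assert (HT : T0 < T /\ 0 <= T).
  { unfold T. pose proof (Rmax_l T0 0). pose proof (Rmax_r T0 0). lra. }
  set (A := Rabs (f T)).
  assert (HA : 0 <= A) by apply Rabs_pos.
  (* [exp u >= 1 + u] makes the transient smaller than [eps / 2] from here on. *)
  exists (T + 2 * A / (c * eps)); intros t Ht.
  assert (Hce : 0 < c * eps) by nra.
  assert (0 <= 2 * A / (c * eps)) by (apply Rdiv_le_0_compat; lra).
  assert (Hbd := damped_bound f b c (c * eps / 2) T t Hc ltac:(lra)
    (fun s Hs => Hf s ltac:(lra))).
  destruct HT as [HT HT'].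
  assert (Hle : forall s, T <= s -> Rabs (b s) <= c * eps / 2).
  { intros s Hs. specialize (HT0 s ltac:(lra)). rewrite Rminus_0_r in HT0. lra. }
  specialize (Hbd Hle). fold A in Hbd.
  replace (c * eps / 2 / c) with (eps / 2) in Hbd by (field; lra).
  rewrite Rminus_0_r.
  enough (A * exp (- c * (t - T)) < eps / 2) by lra.
  replace (- c * (t - T)) with (- (c * (t - T))) by ring.
  rewrite exp_Ropp.
  assert (Hu : 2 * A < c * (t - T) * eps).
  { replace (2 * A) with (2 * A / (c * eps) * (c * eps)) by (field; lra).
    replace (c * (t - T) * eps) with ((t - T) * (c * eps)) by ring.
    apply Rmult_lt_compat_r; lra. }
  assert (0 < c * (t - T)) by (apply Rmult_lt_0_compat; lra).
  assert (He := exp_ineq1 (c * (t - T)) ltac:(lra)).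
  set (E := exp (c * (t - T))) in *.
  apply (Rmult_lt_reg_r E); [lra |].
  rewrite Rmult_assoc, Rinv_l by lra. nra.
Qed.

Lemma strictly_increasing_of_derive (f df : R -> R) :
  (forall t, is_derive f t (df t)) -> (forall t, 0 < df t) ->
  forall a b, a < b -> f a < f b.
Proof.
  intros Hd Hpos a b Hab.
  apply (increasing_of_derive f df); auto.
Qed.

Lemma inverse_derivable (f df : R -> R) :
  (forall t, is_derive f t (df t)) -> (forall t, 0 < df t) ->
  (forall s, exists t, f t = s) ->
  exists g : R -> R, (forall s, f (g s) = s) /\ (forall t, g (f t) = t) /\
    (forall s, is_derive g s (/ df (g s))).
Proof.
  intros Hd Hpos Hsurj.
  set (g := fun s => proj1_sig (constructive_indefinite_description _ (Hsurj s))).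
  assert (Hfg : forall s, f (g s) = s).
  { intros s. unfold g. destruct (constructive_indefinite_description _ _); auto. }
  assert (Hinc := strictly_increasing_of_derive f df Hd Hpos).
  assert (Hinc' : forall a b, f a < f b -> a < b).
  { intros a b Hab. destruct (Rlt_le_dec a b) as [| [Hba | ->]]; auto; [| lra].
    specialize (Hinc b a Hba). lra. }
  exists g. split; [exact Hfg | split].
  - intros t. destruct (Rtotal_order (g (f t)) t) as [H | [H | H]]; auto;
      apply Hinc in H; rewrite Hfg in H; lra.
  - intros s. apply is_derive_Reals.
    set (t := g s). assert (Hft : f t = s) by apply Hfg.
    assert (Hw := Hpos t). set (w := df t) in *.
    intros eps Heps.
    set (eta := Rmin (w / 2) (eps * (w * w) / 4)).
    assert (Hw2 : 0 < w * w) by nra.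
    assert (Heta : 0 < eta).
    { apply Rmin_glb_lt; [lra |]. apply Rdiv_lt_0_compat; nra. }
    assert (Heta1 : eta <= w / 2) by apply Rmin_l.
    assert (Heta2 : eta <= eps * (w * w) / 4) by apply Rmin_r.
    destruct (proj1 (is_derive_Reals _ _ _) (Hd t) eta Heta) as [d Hdd].
    assert (Hdp := cond_pos d).
    assert (Hl := Hinc (t - d) t ltac:(lra)). assert (Hr := Hinc t (t + d) ltac:(lra)).
    assert (Hdel : 0 < Rmin (f (t + d) - s) (s - f (t - d))).
    { apply Rmin_glb_lt; lra. }
    exists (mkposreal _ Hdel); simpl. intros h Hh0 Hh.
    assert (Hh1 := Rlt_le_trans _ _ _ Hh (Rmin_l _ _)).
    assert (Hh2 := Rlt_le_trans _ _ _ Hh (Rmin_r _ _)).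
    apply Rabs_def2 in Hh1. apply Rabs_def2 in Hh2.
    set (k := g (s + h) - t).
    assert (Hfk : f (t + k) = s + h).
    { unfold k. replace (t + (g (s + h) - t)) with (g (s + h)) by ring. apply Hfg. }
    assert (Hk0 : k <> 0).
    { intros Hk. rewrite Hk, Rplus_0_r in Hfk. lra. }
    assert (Hk : Rabs k < d).
    { apply Rabs_def1.
      - assert (t + k < t + d) by (apply Hinc'; lra). lra.
      - assert (t - d < t + k) by (apply Hinc'; lra). lra. }
    specialize (Hdd k Hk0 Hk). rewrite Hfk, Hft in Hdd. fold w in Hdd.
    replace (s + h - s) with h in Hdd by ring.
    set (q := h / k) in *.
    apply Rabs_def2 in Hdd.
    assert (Hq : w / 2 < q) by lra.
    change (g s) with t.
    replace ((g (s + h) - t) / h) with (/ q) by (unfold q; fold k; field; auto).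
    replace (/ q - / w) with ((w - q) / (q * w)) by (field; lra).
    assert (Hqw : w * w / 2 < q * w) by nra.
    rewrite Rabs_div by nra. rewrite (Rabs_pos_eq (q * w)) by nra.
    assert (Rabs (w - q) < eta) by (apply Rabs_def1; lra).
    apply (Rmult_lt_reg_r (q * w)); [lra |].
    unfold Rdiv. rewrite Rmult_assoc, Rinv_l, Rmult_1_r by lra. nra.
Qed.

Lemma is_derive_sq_negpart (u : R) :
  is_derive (fun u => (Rmin u 0) ^ 2) u (2 * Rmin u 0).
Proof.
  destruct (Rtotal_order u 0) as [Hu | [-> | Hu]].
  - apply (is_derive_ext_loc (fun u => u ^ 2)).
    + apply (locally_interval _ u m_infty 0); simpl; auto.
      intros z _ Hz. rewrite Rmin_left; lra.
    + rewrite Rmin_left by lra. auto_derive; auto. ring.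
  - rewrite Rmin_left by lra. apply is_derive_Reals. intros eps Heps.
    exists (mkposreal eps Heps); simpl. intros h Hh Hlt.
    rewrite Rplus_0_l, (Rmin_left 0 0) by lra.
    unfold Rmin; destruct (Rle_dec h 0).
    + replace ((h * (h * 1) - 0 * (0 * 1)) / h - 2 * 0) with h by (field; auto). auto.
    + replace ((0 * (0 * 1) - 0 * (0 * 1)) / h - 2 * 0) with 0 by (field; auto).
      rewrite Rabs_R0. auto.
  - apply (is_derive_ext_loc (fun _ => 0)).
    + apply (locally_interval _ u 0 p_infty); simpl; auto.
      intros z Hz _. rewrite Rmin_right by lra. ring.
    + rewrite Rmin_right, Rmult_0_r by lra. apply @is_derive_const.
Qed.

(** The squared negative part of [f - m] is differentiable and can never grow
    if [f] does not decrease while it is below [m]. *)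
Lemma lower_barrier (f df : R -> R) (m : R) :
  (forall t, 0 <= t -> is_derive f t (df t)) ->
  (forall t, 0 <= t -> f t < m -> 0 <= df t) ->
  m <= f 0 -> forall t, 0 <= t -> m <= f t.
Proof.
  intros Hd Hs H0 t Ht.
  assert (H : (Rmin (f t - m) 0) ^ 2 <= (Rmin (f 0 - m) 0) ^ 2).
  { apply (nonincreasing_of_derive (fun s => (Rmin (f s - m) 0) ^ 2)
      (fun s => df s * (2 * Rmin (f s - m) 0))); auto.
    - intros s Hs'. specialize (Hd s ltac:(lra)).
      apply (is_derive_comp (fun u => (Rmin u 0) ^ 2) (fun s => f s - m)).
      + apply is_derive_sq_negpart.
      + derive_from_context. ring.
    - intros s Hs'. unfold Rmin. destruct (Rle_dec (f s - m) 0) as [Hle | Hgt]; [| lra].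
      destruct Hle as [Hlt | Heq]; [| rewrite Heq; lra].
      specialize (Hs s ltac:(lra) ltac:(lra)). nra. }
  rewrite (Rmin_right (f 0 - m) 0) in H by lra.
  apply Rnot_lt_le; intros Hlt. rewrite Rmin_left in H by lra. nra.
Qed.

Lemma positive_of_nonvanishing (f : R -> R) (t : R) :
  (forall t, ex_derive f t) -> 0 <= t -> 0 < f 0 ->
  (forall s, 0 <= s <= t -> f s <> 0) -> 0 < f t.
Proof.
  intros Hf Ht H0 Hn. apply Rnot_le_lt; intros Hle.
  destruct (IVT_gen f 0 t 0) as (s & Hs & Hfs).
  - intros s. apply continuity_pt_filterlim, @ex_derive_continuous, Hf.
  - rewrite Rmin_right, Rmax_left by lra. lra.
  - rewrite Rmin_left, Rmax_right in Hs by lra. apply (Hn s); auto.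
Qed.

Lemma Rabs_le_1_plus_sq u : Rabs u <= 1 + u ^ 2.
Proof. rewrite <- pow2_abs. pose proof (Rabs_pos u). nra. Qed.

Lemma is_derive_integral (c : R) (f : R -> R) :
  (forall t, continuous f t) -> forall t, is_derive (fun t => c + RInt f 0 t) t (f t).
Proof.
  intros Hf t.
  assert (H : is_derive (RInt f 0) t (f t)).
  { apply (is_derive_RInt f (RInt f 0) 0 t); [| apply Hf].
    apply filter_forall. intros s. apply (RInt_correct f), (ex_RInt_continuous f).
    intros z _. apply Hf. }
  evar_last.
  - apply (is_derive_plus (fun _ => c) (RInt f 0)); [apply is_derive_const | exact H].
  - apply Rplus_0_l.
Qed.

(** * Planar Lipschitz systems: existence and uniqueness *)

(** [D exp (- K t)] decreases and [D exp (K t)] increases, so a zero of [D] spreads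
    in both directions of time. *)
Lemma gronwall_zero (D dD : R -> R) (K a b t0 : R) :
  a <= t0 <= b ->
  (forall t, a <= t <= b -> is_derive D t (dD t)) ->
  (forall t, a <= t <= b -> 0 <= D t) ->
  (forall t, a <= t <= b -> Rabs (dD t) <= K * D t) ->
  D t0 = 0 -> forall t, a <= t <= b -> D t = 0.
Proof.
  intros Ht0 Hd Hpos HK H0 t Ht.
  apply Rle_antisym; [| auto].
  destruct (Rle_lt_dec t0 t) as [Hle | Hlt].
  - assert (H : D t * exp (- K * t) <= D t0 * exp (- K * t0)).
    { apply (nonincreasing_of_derive (fun s => D s * exp (- K * s))
        (fun s => (dD s - K * D s) * exp (- K * s))); auto.
      - intros s Hs. specialize (Hd s ltac:(lra)). derive_from_context. ring.
      - intros s Hs. specialize (HK s ltac:(lra)). apply Rabs_le_between in HK.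
        pose proof (exp_pos (- K * s)). nra. }
    rewrite H0, Rmult_0_l in H. pose proof (exp_pos (- K * t)). nra.
  - assert (H : D t * exp (K * t) <= D t0 * exp (K * t0)).
    { apply (nondecreasing_of_derive (fun s => D s * exp (K * s))
        (fun s => (dD s + K * D s) * exp (K * s))); [lra | |].
      - intros s Hs. specialize (Hd s ltac:(lra)). derive_from_context. ring.
      - intros s Hs. specialize (HK s ltac:(lra)). apply Rabs_le_between in HK.
        pose proof (exp_pos (K * s)). nra. }
    rewrite H0, Rmult_0_l in H. pose proof (exp_pos (K * t)). nra.
Qed.

Definition lipschitz2 (L : R) (u : R -> R -> R) : Prop :=
  forall x y x' y', Rabs (u x y - u x' y') <= L * (Rabs (x - x') + Rabs (y - y')).

Definition solves (u v : R -> R -> R) (x y : R -> R) (t : R) : Prop :=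
  is_derive x t (u (x t) (y t)) /\ is_derive y t (v (x t) (y t)).

Lemma solution_unique (u v : R -> R -> R) (L : R) (x y x' y' : R -> R) (a b t0 : R) :
  lipschitz2 L u -> lipschitz2 L v -> a <= t0 <= b ->
  (forall t, a <= t <= b -> solves u v x y t) ->
  (forall t, a <= t <= b -> solves u v x' y' t) ->
  x t0 = x' t0 -> y t0 = y' t0 ->
  forall t, a <= t <= b -> x t = x' t /\ y t = y' t.
Proof.
  intros Hu Hv Ht0 Hs Hs' Hx Hy t Ht.
  assert (H : (x t - x' t) ^ 2 + (y t - y' t) ^ 2 = 0).
  { apply (gronwall_zero (fun t => (x t - x' t) ^ 2 + (y t - y' t) ^ 2)
      (fun t => 2 * (x t - x' t) * (u (x t) (y t) - u (x' t) (y' t))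
              + 2 * (y t - y' t) * (v (x t) (y t) - v (x' t) (y' t))) (4 * L) a b t0); auto.
    - intros s Hst. destruct (Hs s Hst) as [H1 H2]. destruct (Hs' s Hst) as [H3 H4].
      derive_from_context. ring.
    - intros s Hst. apply Rplus_le_le_0_compat; apply pow2_ge_0.
    - intros s Hst.
      specialize (Hu (x s) (y s) (x' s) (y' s)). specialize (Hv (x s) (y s) (x' s) (y' s)).
      set (p := x s - x' s) in *. set (q := y s - y' s) in *.
      set (du := u (x s) (y s) - u (x' s) (y' s)) in *.
      set (dv := v (x s) (y s) - v (x' s) (y' s)) in *.
      replace (2 * p * du + 2 * q * dv) with (2 * (p * du) + 2 * (q * dv)) by ring.
      eapply Rle_trans; [apply Rabs_triang |].
      rewrite !Rabs_mult, (Rabs_pos_eq 2) by lra.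
      rewrite <- (pow2_abs p), <- (pow2_abs q).
      pose proof (Rabs_pos p). pose proof (Rabs_pos q).
      assert (HL : 0 <= L * (Rabs p + Rabs q)).
      { pose proof (Rabs_pos du). lra. }
      assert (Rabs p * Rabs du <= Rabs p * (L * (Rabs p + Rabs q)))
        by (apply Rmult_le_compat_l; auto).
      assert (Rabs q * Rabs dv <= Rabs q * (L * (Rabs p + Rabs q)))
        by (apply Rmult_le_compat_l; auto).
      assert (0 <= L \/ Rabs p + Rabs q = 0).
      { destruct (Rle_lt_dec 0 L); [auto | right; nra]. }
      destruct H3 as [HL0 | Hz].
      + assert (0 <= L * (Rabs p - Rabs q) ^ 2) by (apply Rmult_le_pos; [auto | apply pow2_ge_0]).
        nra.
      + assert (Rabs p = 0) by lra. assert (Rabs q = 0) by lra. rewrite H3, H4 in *. nra.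
    - simpl. rewrite Hx, Hy. ring. }
  rewrite <- !Rsqr_pow2 in H. apply Rplus_sqr_eq_0 in H. lra.
Qed.

(** The exponential weight is reproduced by integration up to the factor [1 / K];
    the contraction property of the Picard iteration comes from it. *)
Lemma exp_growth_bound (f df : R -> R) (M K : R) :
  0 < K -> f 0 = 0 ->
  (forall t, is_derive f t (df t)) ->
  (forall t, Rabs (df t) <= M * exp (K * Rabs t)) ->
  forall t, Rabs (f t) <= M / K * exp (K * Rabs t).
Proof.
  intros HK H0 Hd Hb.
  assert (HM : 0 <= M).
  { specialize (Hb 0). rewrite Rabs_R0, Rmult_0_r, exp_0 in Hb.
    pose proof (Rabs_pos (df 0)). lra. }
  assert (HMK : 0 <= M / K) by (apply Rdiv_le_0_compat; lra).
  assert (Hstep : forall g dg : R -> R, g 0 = 0 ->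
    (forall t, is_derive g t (dg t)) -> (forall t, 0 <= t -> dg t <= M * exp (K * t)) ->
    forall t, 0 <= t -> g t <= M / K * exp (K * t)).
  { intros g dg Hg0 Hg Hgb t Ht.
    assert (H : g t - M / K * exp (K * t) <= g 0 - M / K * exp (K * 0)).
    { apply (nonincreasing_of_derive (fun s => g s - M / K * exp (K * s))
        (fun s => dg s - M * exp (K * s))); auto.
      - intros s Hs. specialize (Hg s). derive_from_context. field. lra.
      - intros s Hs. specialize (Hgb s ltac:(lra)). lra. }
    rewrite Hg0, Rmult_0_r, exp_0 in H. lra. }
  assert (Hpos : forall g dg : R -> R, g 0 = 0 ->
    (forall t, is_derive g t (dg t)) ->
    (forall t, 0 <= t -> Rabs (dg t) <= M * exp (K * t)) ->
    forall t, 0 <= t -> Rabs (g t) <= M / K * exp (K * t)).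
  { intros g dg Hg0 Hg Hgb t Ht. apply Rabs_le; split.
    - enough (- g t <= M / K * exp (K * t)) by lra.
      apply (Hstep (fun s => - g s) (fun s => - dg s)); auto.
      + rewrite Hg0; ring.
      + intros s. specialize (Hg s). derive_from_context. ring.
      + intros s Hs. specialize (Hgb s Hs). apply Rabs_le_between in Hgb. lra.
    - apply (Hstep g dg); auto.
      intros s Hs. specialize (Hgb s Hs). apply Rabs_le_between in Hgb. lra. }
  intros t. destruct (Rle_lt_dec 0 t) as [Ht | Ht].
  - rewrite (Rabs_pos_eq t) by auto. apply (Hpos f df); auto.
    intros s Hs. specialize (Hb s). rewrite (Rabs_pos_eq s) in Hb; auto.
  - rewrite (Rabs_left t) by auto.
    replace (f t) with (f (- - t)) by (f_equal; ring).
    apply (Hpos (fun s => f (- s)) (fun s => - df (- s))).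
    + rewrite Ropp_0; auto.
    + intros s. assert (H := Hd (- s)). auto_derive.
      * eexists; exact H.
      * change (Derive (fun r => f r) (- s)) with (Derive f (- s)).
        rewrite (is_derive_unique _ _ _ H). ring.
    + intros s Hs. rewrite Rabs_Ropp. specialize (Hb (- s)).
      rewrite Rabs_Ropp, (Rabs_pos_eq s) in Hb; auto.
    + lra.
Qed.

Lemma geometric_cauchy (f : nat -> R) (C : R) :
  (forall n, Rabs (f (S n) - f n) <= C * (1 / 2) ^ n) ->
  forall N n, (N <= n)%nat -> Rabs (f n - f N) <= 2 * C * (1 / 2) ^ N.
Proof.
  intros Hf N n Hn.
  assert (HC : 0 <= C).
  { specialize (Hf 0%nat). simpl in Hf. pose proof (Rabs_pos (f 1%nat - f 0%nat)). lra. }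
  assert (H : Rabs (f n - f N) <= 2 * C * ((1 / 2) ^ N - (1 / 2) ^ n)).
  { induction Hn as [| n Hn IH].
    - rewrite !Rminus_diag, Rabs_R0. lra.
    - replace (f (S n) - f N) with ((f (S n) - f n) + (f n - f N)) by ring.
      eapply Rle_trans; [apply Rabs_triang |].
      specialize (Hf n). simpl. nra. }
  assert (0 < (1 / 2) ^ n) by (apply pow_lt; lra). nra.
Qed.

Lemma continuous_lipschitz2 (u : R -> R -> R) (L : R) (x y : R -> R) (t : R) :
  lipschitz2 L u -> continuous x t -> continuous y t ->
  continuous (fun s => u (x s) (y s)) t.
Proof.
  intros Hu Hx Hy. apply filterlim_locally. intros eps.
  assert (HL : 0 < Rabs L + 1) by (pose proof (Rabs_pos L); lra).
  assert (Hd : 0 < eps / (2 * (Rabs L + 1))).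
  { apply Rdiv_lt_0_compat; [apply cond_pos | lra]. }
  set (d := mkposreal _ Hd).
  apply filterlim_locally with (eps := d) in Hx.
  apply filterlim_locally with (eps := d) in Hy.
  eapply filter_imp; [| exact (filter_and _ _ Hx Hy)].
  intros s [H1 H2]. change (Rabs (x s - x t) < d) in H1. change (Rabs (y s - y t) < d) in H2.
  change (Rabs (u (x s) (y s) - u (x t) (y t)) < eps).
  eapply Rle_lt_trans; [apply Hu |].
  assert (He : (Rabs L + 1) * (d + d) = eps) by (unfold d; simpl; field; lra).
  pose proof (Rle_abs L). pose proof (Rabs_pos (x s - x t)). pose proof (Rabs_pos (y s - y t)).
  pose proof (Rabs_pos L). nra.
Qed.

Lemma half_pow_small (B eps : R) : 0 < eps -> exists N, B * (1 / 2) ^ N < eps.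
Proof.
  intros He.
  assert (HB : 0 < Rabs B + 1) by (pose proof (Rabs_pos B); lra).
  assert (Hhalf : Rabs (1 / 2) < 1) by (apply Rabs_def1; lra).
  destruct (pow_lt_1_zero (1 / 2) Hhalf (eps / (Rabs B + 1))) as [N HN].
  { apply Rdiv_lt_0_compat; lra. }
  exists N. specialize (HN N (le_n N)).
  assert (0 < (1 / 2) ^ N) by (apply pow_lt; lra).
  rewrite Rabs_pos_eq in HN by lra.
  apply (Rmult_lt_compat_r (Rabs B + 1)) in HN; [| lra].
  unfold Rdiv in HN at 2. rewrite Rmult_assoc, Rinv_l, Rmult_1_r in HN by lra.
  pose proof (Rle_abs B). nra.
Qed.

Lemma cvu_of_geometric (f : nat -> R -> R) (D : R -> Prop) (B : R) :
  (forall N n t, D t -> (N <= n)%nat -> Rabs (f n t - f N t) <= B * (1 / 2) ^ N) ->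
  CVU_dom f D.
Proof.
  intros Hf. apply CVU_dom_cauchy. intros eps.
  destruct (half_pow_small (2 * B) eps (cond_pos eps)) as [N HN].
  exists N. intros n m t Ht Hn Hm.
  replace (f n t - f m t) with ((f n t - f N t) - (f m t - f N t)) by ring.
  eapply Rle_lt_trans; [apply Rabs_triang |]. rewrite Rabs_Ropp.
  pose proof (Hf N n t Ht Hn). pose proof (Hf N m t Ht Hm). lra.
Qed.

Section Picard.

Variables (u v : R -> R -> R) (L x0 y0 : R).
Hypotheses (HL : 0 < L) (Hu : lipschitz2 L u) (Hv : lipschitz2 L v).

Fixpoint picard (n : nat) : (R -> R) * (R -> R) :=
  match n with
  | O => (fun _ => x0, fun _ => y0)
  | S n =>
      (fun t => x0 + RInt (fun s => u (fst (picard n) s) (snd (picard n) s)) 0 t,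
       fun t => y0 + RInt (fun s => v (fst (picard n) s) (snd (picard n) s)) 0 t)
  end.

Lemma picard_continuous n t :
  continuous (fst (picard n)) t /\ continuous (snd (picard n)) t.
Proof.
  revert t. induction n as [| n IH]; intros t; simpl.
  - split; apply continuous_const.
  - split; apply @ex_derive_continuous; eexists;
      refine (is_derive_integral _ _ _ t); intros s;
      apply (continuous_lipschitz2 _ L); auto; apply IH.
Qed.

Lemma picard_derive n t :
  is_derive (fst (picard (S n))) t (u (fst (picard n) t) (snd (picard n) t)) /\
  is_derive (snd (picard (S n))) t (v (fst (picard n) t) (snd (picard n) t)).
Proof.
  simpl. split; refine (is_derive_integral _ _ _ t); intros s;
    apply (continuous_lipschitz2 _ L); auto; apply picard_continuous.
Qed.

Lemma picard_0 n : fst (picard n) 0 = x0 /\ snd (picard n) 0 = y0.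
Proof.
  destruct n; simpl; auto. rewrite !RInt_point. unfold zero; simpl. split; ring.
Qed.

(** The weight [exp (4 L |t|)] turns the Picard operator into a contraction of
    ratio 1/2 on the whole line, so no gluing of local solutions is needed. *)
Lemma picard_contracts : exists C, forall n t,
  Rabs (fst (picard (S n)) t - fst (picard n) t) +
  Rabs (snd (picard (S n)) t - snd (picard n) t) <= C * exp (4 * L * Rabs t) * (1 / 2) ^ n.
Proof.
  set (K := 4 * L). assert (HK : 0 < K) by (unfold K; lra).
  set (M := Rabs (u x0 y0) + Rabs (v x0 y0)).
  exists (2 * M / K). induction n as [| n IH]; intros t.
  - assert (HM : forall s, M <= M * exp (K * Rabs s)).
    { intros s. pose proof (Rabs_pos s). pose proof (Rabs_pos (u x0 y0)).
      pose proof (Rabs_pos (v x0 y0)).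
      destruct (Rle_lt_or_eq_dec 0 (K * Rabs s)) as [Hlt | <-]; [nra | |].
      - pose proof (exp_ineq1 _ (Rgt_not_eq _ _ Hlt)). unfold M. nra.
      - rewrite exp_0. lra. }
    assert (Hd := picard_derive 0). assert (Hz := picard_0 1).
    set (p1 := picard 1) in *.
    assert (H1 := exp_growth_bound (fun s => fst p1 s - x0) (fun _ => u x0 y0) M K HK).
    assert (H2 := exp_growth_bound (fun s => snd p1 s - y0) (fun _ => v x0 y0) M K HK).
    assert (Hx : Rabs (fst p1 t - x0) <= M / K * exp (K * Rabs t)).
    { apply H1.
      - rewrite (proj1 Hz). ring.
      - intros s. destruct (Hd s) as [Hs _]. change (is_derive (fst p1) s (u x0 y0)) in Hs.
        derive_from_context. ring.
      - intros s. specialize (HM s). pose proof (Rabs_pos (v x0 y0)). unfold M in *. lra. }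
    assert (Hy : Rabs (snd p1 t - y0) <= M / K * exp (K * Rabs t)).
    { apply H2.
      - rewrite (proj2 Hz). ring.
      - intros s. destruct (Hd s) as [_ Hs]. change (is_derive (snd p1) s (v x0 y0)) in Hs.
        derive_from_context. ring.
      - intros s. specialize (HM s). pose proof (Rabs_pos (u x0 y0)). unfold M in *. lra. }
    change (fst (picard 0) t) with x0. change (snd (picard 0) t) with y0.
    rewrite pow_O. unfold Rdiv in *. lra.
  - set (C := 2 * M / K) in *. set (A := C * (1 / 2) ^ n) in *.
    assert (Hdiff : forall w : R -> R -> R, lipschitz2 L w -> forall s,
      Rabs (w (fst (picard (S n)) s) (snd (picard (S n)) s)
            - w (fst (picard n) s) (snd (picard n) s)) <= L * A * exp (K * Rabs s)).
    { intros w Hw s. eapply Rle_trans; [apply Hw |].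
      specialize (IH s). unfold A.
      replace (L * (C * (1 / 2) ^ n) * exp (K * Rabs s))
        with (L * (C * exp (K * Rabs s) * (1 / 2) ^ n)) by ring.
      apply Rmult_le_compat_l; lra. }
    assert (Hx := fun df => exp_growth_bound
      (fun s => fst (picard (S (S n))) s - fst (picard (S n)) s) df (L * A) K HK).
    assert (Hy := fun df => exp_growth_bound
      (fun s => snd (picard (S (S n))) s - snd (picard (S n)) s) df (L * A) K HK).
    assert (Hd1 := picard_derive (S n)). assert (Hd0 := picard_derive n).
    assert (Hz1 := picard_0 (S (S n))). assert (Hz0 := picard_0 (S n)).
    assert (HLK : L * A / K = A / 4) by (unfold K; field; lra).
    set (p2 := picard (S (S n))) in *. set (p1 := picard (S n)) in *. set (p0 := picard n) in *.
    assert (Hx' : Rabs (fst p2 t - fst p1 t) <= L * A / K * exp (K * Rabs t)).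
    { refine (Hx _ _ _ (Hdiff u Hu) t); cbv beta.
      - rewrite (proj1 Hz1), (proj1 Hz0). ring.
      - intros s. destruct (Hd1 s) as [Ha _]. destruct (Hd0 s) as [Hb _].
        derive_from_context. ring. }
    assert (Hy' : Rabs (snd p2 t - snd p1 t) <= L * A / K * exp (K * Rabs t)).
    { refine (Hy _ _ _ (Hdiff v Hv) t); cbv beta.
      - rewrite (proj2 Hz1), (proj2 Hz0). ring.
      - intros s. destruct (Hd1 s) as [_ Ha]. destruct (Hd0 s) as [_ Hb].
        derive_from_context. ring. }
    rewrite HLK in Hx', Hy'. unfold A in *.
    change ((1 / 2) ^ S n) with (1 / 2 * (1 / 2) ^ n). lra.
Qed.

(** On bounded time intervals the Picard iterates converge uniformly, and so do
    their derivatives, which are the fields evaluated along the preceding iterates.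
    The limit is therefore differentiable with the right derivative. *)
Theorem solution_exists :
  exists x y : R -> R, (forall t, solves u v x y t) /\ x 0 = x0 /\ y 0 = y0.
Proof.
  destruct picard_contracts as [C HC].
  set (px := fun n t => fst (picard (S n)) t). set (py := fun n t => snd (picard (S n)) t).
  set (E := fun t => exp (4 * L * Rabs t)) in *.
  assert (HE : forall t, 0 < E t) by (intros; apply exp_pos).
  assert (HC0 : 0 <= C).
  { specialize (HC 0%nat 0). fold (E 0) in HC. rewrite pow_O in HC. specialize (HE 0).
    pose proof (Rabs_pos (fst (picard 1) 0 - fst (picard 0) 0)).
    pose proof (Rabs_pos (snd (picard 1) 0 - snd (picard 0) 0)). nra. }
  assert (Hgx : forall t N n, (N <= n)%nat ->
    Rabs (fst (picard n) t - fst (picard N) t) <= 2 * (C * E t) * (1 / 2) ^ N).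
  { intros t. apply (geometric_cauchy (fun n => fst (picard n) t)). intros n.
    specialize (HC n t). fold (E t) in HC.
    pose proof (Rabs_pos (snd (picard (S n)) t - snd (picard n) t)). lra. }
  assert (Hgy : forall t N n, (N <= n)%nat ->
    Rabs (snd (picard n) t - snd (picard N) t) <= 2 * (C * E t) * (1 / 2) ^ N).
  { intros t. apply (geometric_cauchy (fun n => snd (picard n) t)). intros n.
    specialize (HC n t). fold (E t) in HC.
    pose proof (Rabs_pos (fst (picard (S n)) t - fst (picard n) t)). lra. }
  set (X := fun t => real (Lim_seq (fun n => px n t))).
  set (Y := fun t => real (Lim_seq (fun n => py n t))).
  assert (HEmon : forall T t, Rabs t < T -> E t <= E T).
  { intros T t Ht. left. apply exp_increasing. pose proof (Rle_abs T).
    apply Rmult_lt_compat_l; lra. }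
  assert (Hpow : forall N, 0 < (1 / 2) ^ N) by (intros; apply pow_lt; lra).
  assert (HB : forall T t N, Rabs t < T ->
    2 * (C * E t) * (1 / 2) ^ S N <= C * E T * (1 / 2) ^ N).
  { intros T t N Ht. specialize (HEmon T t Ht). specialize (Hpow N).
    change ((1 / 2) ^ S N) with (1 / 2 * (1 / 2) ^ N).
    replace (2 * (C * E t) * (1 / 2 * (1 / 2) ^ N)) with (C * E t * (1 / 2) ^ N) by field.
    apply Rmult_le_compat_r; [lra |]. apply Rmult_le_compat_l; lra. }
  assert (HcvX : forall T, CVU_dom px (fun t => Rabs t < T)).
  { intros T. apply (cvu_of_geometric _ _ (C * E T)). intros N n t Ht Hn.
    eapply Rle_trans; [apply Hgx; lia | auto]. }
  assert (HcvY : forall T, CVU_dom py (fun t => Rabs t < T)).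
  { intros T. apply (cvu_of_geometric _ _ (C * E T)). intros N n t Ht Hn.
    eapply Rle_trans; [apply Hgy; lia | auto]. }
  assert (HlX : forall t, is_lim_seq (fun n => px n t) (X t)).
  { intros t. apply Lim_seq_correct'.
    apply (CVU_CVS_dom _ _ (HcvX (Rabs t + 1))). lra. }
  assert (HlY : forall t, is_lim_seq (fun n => py n t) (Y t)).
  { intros t. apply Lim_seq_correct'.
    apply (CVU_CVS_dom _ _ (HcvY (Rabs t + 1))). lra. }
  assert (Hlim : forall w, lipschitz2 L w -> forall t,
    is_lim_seq (fun n => w (fst (picard n) t) (snd (picard n) t)) (w (X t) (Y t))).
  { intros w Hw t. apply is_lim_seq_incr_1.
    apply is_lim_seq_spec. intros eps.
    assert (Hd : 0 < eps / (2 * L)) by (apply Rdiv_lt_0_compat; [apply cond_pos | lra]).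
    assert (H1 := proj2 (is_lim_seq_spec _ _) (HlX t) (mkposreal _ Hd)).
    assert (H2 := proj2 (is_lim_seq_spec _ _) (HlY t) (mkposreal _ Hd)).
    eapply filter_imp; [| exact (filter_and _ _ H1 H2)].
    intros n [Hn1 Hn2]. simpl pos in *.
    eapply Rle_lt_trans; [apply Hw |].
    assert (HLe : eps = L * (eps / (2 * L) + eps / (2 * L)) :> R) by (field; lra).
    rewrite HLe. apply Rmult_lt_compat_l; [lra |].
    unfold px, py in *. simpl in *. lra. }
  assert (Hder : forall (p : nat -> R -> R) (w : R -> R -> R) (t : R), lipschitz2 L w ->
    (forall T, CVU_dom p (fun t => Rabs t < T)) ->
    (forall n s, is_derive (p n) s (w (fst (picard n) s) (snd (picard n) s))) ->
    is_derive (fun t => real (Lim_seq (fun n => p n t))) t (w (X t) (Y t))).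
  { intros p w t Hw Hcv Hp. set (T := Rabs t + 1).
    replace (w (X t) (Y t)) with (real (Lim_seq (fun n => Derive (p n) t))).
    2: { rewrite (Lim_seq_ext _ _ (fun n => is_derive_unique _ _ _ (Hp n t))).
         rewrite (is_lim_seq_unique _ _ (Hlim w Hw t)). reflexivity. }
    apply (CVU_Derive p (fun t => Rabs t < T)).
    - apply (open_comp Rabs (fun z => z < T)); [| apply open_lt].
      intros s _. apply continuous_Rabs.
    - intros a b c Ha Hb Hc. apply Rabs_def1;
        apply Rabs_def2 in Ha; apply Rabs_def2 in Hb; lra.
    - apply Hcv.
    - intros n s _. eexists; apply Hp.
    - intros n s _. apply continuity_pt_filterlim.
      apply (continuous_ext (fun s => w (fst (picard n) s) (snd (picard n) s))).
      + intros r. symmetry. apply is_derive_unique, Hp.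
      + apply (continuous_lipschitz2 _ L); auto; apply picard_continuous.
    - apply (cvu_of_geometric _ _ (4 * L * (C * E T))). intros N n s Hs Hn.
      rewrite !(is_derive_unique _ _ _ (Hp _ s)).
      eapply Rle_trans; [apply Hw |].
      specialize (HEmon T s Hs). specialize (Hpow N).
      assert (C * E s * (1 / 2) ^ N <= C * E T * (1 / 2) ^ N).
      { apply Rmult_le_compat_r; [lra |]. apply Rmult_le_compat_l; lra. }
      pose proof (Hgx s N n Hn). pose proof (Hgy s N n Hn).
      replace (4 * L * (C * E T) * (1 / 2) ^ N) with (L * (4 * (C * E T * (1 / 2) ^ N))) by ring.
      apply Rmult_le_compat_l; lra.
    - unfold T; lra. }
  exists X, Y. split; [| split].
  - intros t. split.
    + apply (Hder px u t Hu HcvX). intros n s. apply picard_derive.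
    + apply (Hder py v t Hv HcvY). intros n s. apply picard_derive.
  - unfold X. rewrite (Lim_seq_ext _ (fun _ => x0)).
    + rewrite Lim_seq_const. reflexivity.
    + intros n. apply (proj1 (picard_0 (S n))).
  - unfold Y. rewrite (Lim_seq_ext _ (fun _ => y0)).
    + rewrite Lim_seq_const. reflexivity.
    + intros n. apply (proj2 (picard_0 (S n))).
Qed.

End Picard.

(** * Lienard systems: symmetries, energy, crossings *)

Section Lienard.

(** [Hratio] is the derivative form of the strict increase of [F x / x] for
    [x > 0], the property that drives the whole argument. [Hinner] says that near
    the origin the friction feeds energy into the system. *)
Variables (F F1 : R -> R) (om L a : R).
Hypotheses
  (Hom : 0 < om)
  (HF : forall x, is_derive F x (F1 x))
  (HF1c : forall x, continuous F1 x)
  (Hodd : forall x, F (- x) = - F x)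
  (HL : forall x, Rabs (F1 x) <= L)
  (Hratio : forall x, 0 < x -> F x < x * F1 x)
  (Ha : 0 < a)
  (Hinner : forall x, Rabs x <= a -> x * F x <= 0).

Definition lienard (x y : R -> R) : Prop :=
  forall t, solves (fun x y => om * y - F x) (fun x _ => - om * x) x y t.

Hypothesis Hbounded : forall x y, lienard x y ->
  exists M, forall t, 0 <= t -> x t ^ 2 + y t ^ 2 <= M.

Lemma friction_0 : F 0 = 0.
Proof. assert (H := Hodd 0). rewrite Ropp_0 in H. lra. Qed.

Lemma friction_constant_ge0 : 0 <= L.
Proof. specialize (HL 0). pose proof (Rabs_pos (F1 0)). lra. Qed.

Lemma friction_lipschitz x x' : Rabs (F x - F x') <= L * Rabs (x - x').
Proof.
  assert (H : forall p q, p <= q -> Rabs (F q - F p) <= L * Rabs (q - p)).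
  { intros p q Hpq. rewrite (Rabs_pos_eq (q - p)) by lra.
    apply (lipschitz_of_derive F F1); auto. }
  destruct (Rle_lt_dec x' x) as [Hle | Hlt]; auto.
  rewrite (Rabs_minus_sym (F x)), (Rabs_minus_sym x). apply H; lra.
Qed.

Lemma friction_linear_bound x : Rabs (F x) <= L * Rabs x.
Proof. assert (H := friction_lipschitz x 0). rewrite friction_0, !Rminus_0_r in H. exact H. Qed.

Lemma friction_deriv_even x : F1 (- x) = F1 x.
Proof.
  assert (H1 := is_derive_unique _ _ _ (HF x)). rewrite <- H1.
  symmetry. apply is_derive_unique.
  apply (is_derive_ext (fun z => - F (- z))).
  - intros z. rewrite Hodd. apply Ropp_involutive.
  - assert (H := HF (- x)). auto_derive.
    + eexists; exact H.
    + change (Derive (fun r => F r) (- x)) with (Derive F (- x)).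
      rewrite (is_derive_unique _ _ _ H). ring.
Qed.

(** The derivative of [F x / x] is [(x F1 x - F x) / x ^ 2], and [F x / x] is even. *)
Lemma ratio_deriv_ge0 x : 0 <= x * (x * F1 x - F x).
Proof.
  destruct (Rtotal_order x 0) as [Hx | [-> | Hx]].
  - assert (H := Hratio (- x) ltac:(lra)). rewrite Hodd, friction_deriv_even in H. nra.
  - lra.
  - assert (H := Hratio x Hx). nra.
Qed.

Lemma field_lipschitz :
  lipschitz2 (om + L) (fun x y => om * y - F x) /\
  lipschitz2 (om + L) (fun x _ => - om * x).
Proof.
  pose proof friction_constant_ge0.
  split; intros x y x' y'; pose proof (Rabs_pos (x - x')); pose proof (Rabs_pos (y - y')).
  - replace (om * y - F x - (om * y' - F x')) with (om * (y - y') - (F x - F x')) by ring.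
    eapply Rle_trans; [apply Rabs_triang |].
    rewrite Rabs_Ropp, Rabs_mult, (Rabs_pos_eq om) by lra.
    pose proof (friction_lipschitz x x'). nra.
  - replace (- om * x - - om * x') with (- (om * (x - x'))) by ring.
    rewrite Rabs_Ropp, Rabs_mult, (Rabs_pos_eq om) by lra. nra.
Qed.

Lemma lienard_exists x0 y0 : exists x y, lienard x y /\ x 0 = x0 /\ y 0 = y0.
Proof.
  destruct field_lipschitz as [Hu Hv].
  apply (solution_exists _ _ (om + L)); auto. pose proof friction_constant_ge0. lra.
Qed.

Lemma lienard_unique x y x' y' t0 : lienard x y -> lienard x' y' ->
  x t0 = x' t0 -> y t0 = y' t0 -> forall t, x t = x' t /\ y t = y' t.
Proof.
  intros H H' Hx Hy t. destruct field_lipschitz as [Hu Hv].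
  apply (solution_unique _ _ (om + L) x y x' y' (Rmin t t0) (Rmax t t0) t0 Hu Hv);
    auto using Rmin_l, Rmin_r, Rmax_l, Rmax_r.
Qed.

Lemma lienard_opp x y : lienard x y -> lienard (fun t => - x t) (fun t => - y t).
Proof.
  intros H t. destruct (H t) as [H1 H2]. split.
  - rewrite Hodd. derive_from_context. ring.
  - derive_from_context. ring.
Qed.

Lemma lienard_shift x y c : lienard x y -> lienard (fun t => x (t + c)) (fun t => y (t + c)).
Proof.
  intros H t. destruct (H (t + c)) as [H1 H2].
  assert (Hc : is_derive (fun t => t + c) t 1) by (auto_derive; auto; ring).
  split; (evar_last; [eapply (is_derive_comp _ (fun t => t + c)); [eassumption | exact Hc] |]);
    unfold scal; simpl; unfold mult; simpl; ring.
Qed.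

Lemma lienard_zero : lienard (fun _ => 0) (fun _ => 0).
Proof.
  intros t. split; (evar_last; [apply @is_derive_const |]);
    unfold zero; simpl; rewrite ?friction_0; ring.
Qed.

Lemma lienard_nonzero x y t0 : lienard x y -> (x t0, y t0) <> (0, 0) ->
  forall t, 0 < x t ^ 2 + y t ^ 2.
Proof.
  intros H H0 t.
  destruct (Req_dec (x t) 0) as [Hx | Hx]; [| nra].
  destruct (Req_dec (y t) 0) as [Hy | Hy]; [| nra].
  destruct H0. destruct (lienard_unique _ _ _ _ t H lienard_zero Hx Hy t0) as [-> ->]. auto.
Qed.

Lemma energy_derive x y t : lienard x y ->
  is_derive (fun t => x t ^ 2 + y t ^ 2) t (- (2 * (x t * F (x t)))).
Proof.
  intros H. destruct (H t) as [H1 H2]. derive_from_context. ring.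
Qed.

(** Where the energy is below [a ^ 2], the point lies in the strip [|x| <= a], in
    which the energy does not decrease. *)
Lemma energy_lower_bound x y : lienard x y ->
  forall t, 0 <= t -> Rmin (x 0 ^ 2 + y 0 ^ 2) (a ^ 2) <= x t ^ 2 + y t ^ 2.
Proof.
  intros H. set (m := Rmin _ _).
  apply (lower_barrier _ (fun t => - (2 * (x t * F (x t))))).
  - intros t _. apply energy_derive, H.
  - intros t _ Ht. assert (m <= a ^ 2) by apply Rmin_r.
    assert (Hx : Rabs (x t) <= a).
    { rewrite <- (Rabs_pos_eq a) by lra. apply Rsqr_le_abs_0. unfold Rsqr. nra. }
    specialize (Hinner _ Hx). lra.
  - apply Rmin_l.
Qed.

(** A solution that stays in the half plane [x > 0] has [y] decreasing to a limit;
    Barbalat's lemma then forces first [x], then [x'], hence [y], to 0, which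
    the lower bound on the energy forbids. *)
Lemma no_positive_solution x y : lienard x y -> ~ (forall t, 0 <= t -> 0 < x t).
Proof.
  intros H Hpos. destruct (Hbounded x y H) as [M HM].
  set (K := 1 + M).
  assert (HK : forall t, 0 <= t -> Rabs (x t) <= K /\ Rabs (y t) <= K).
  { intros t Ht. specialize (HM t Ht). unfold K.
    pose proof (Rabs_le_1_plus_sq (x t)). pose proof (Rabs_le_1_plus_sq (y t)).
    pose proof (pow2_ge_0 (x t)). pose proof (pow2_ge_0 (y t)). lra. }
  assert (HK0 : 0 <= K).
  { destruct (HK 0 (Rle_refl 0)) as [HK0 _]. pose proof (Rabs_pos (x 0)). lra. }
  pose proof friction_constant_ge0 as HL0.
  set (B := om * K + L * K).
  assert (Hx' : forall t, 0 <= t -> Rabs (om * y t - F (x t)) <= B).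
  { intros t Ht. destruct (HK t Ht) as [Hx Hy]. pose proof (friction_linear_bound (x t)).
    eapply Rle_trans; [apply Rabs_triang |].
    rewrite Rabs_Ropp, Rabs_mult, (Rabs_pos_eq om) by lra. unfold B. nra. }
  destruct (nonincreasing_bounded_lim y (- K)) as [l Hl].
  { intros s t Hs Hst. apply (nonincreasing_of_derive y (fun t => - om * x t)); auto.
    - intros r _. apply H.
    - intros r Hr. specialize (Hpos r ltac:(lra)). nra. }
  { intros t Ht. destruct (HK t Ht) as [_ Hy]. apply Rabs_le_between in Hy. lra. }
  assert (Hlx : is_lim x p_infty 0).
  { assert (Hb : is_lim (fun t => - om * x t) p_infty 0).
    { apply (barbalat y _ (fun t => - om * (om * y t - F (x t))) l (om * B)); auto.
      - intros t _. apply H.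
      - intros t _. destruct (H t) as [H1 H2]. derive_from_context. ring.
      - intros t Ht. rewrite Rabs_mult, Rabs_Ropp, (Rabs_pos_eq om) by lra.
        apply Rmult_le_compat_l; [lra | auto]. }
    apply is_lim_p_infty_eps; intros eps Heps.
    destruct (proj1 (is_lim_p_infty_eps _ _) Hb (om * eps)) as [T HT]; [nra |].
    exists T; intros t Ht. specialize (HT t Ht). rewrite Rminus_0_r in *.
    rewrite Rabs_mult, Rabs_Ropp, (Rabs_pos_eq om) in HT by lra. nra. }
  assert (Hlx' : is_lim (fun t => om * y t - F (x t)) p_infty 0).
  { apply (barbalat x _ (fun t => om * (- om * x t) - F1 (x t) * (om * y t - F (x t)))
      0 (om * om * K + L * B)); auto.
    - intros t _. apply H.
    - intros t _. destruct (H t) as [H1 H2].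
      assert (H3 : is_derive (fun t => F (x t)) t ((om * y t - F (x t)) * F1 (x t))).
      { apply (is_derive_comp F x); auto. }
      set (G := fun t => F (x t)) in *.
      apply (is_derive_ext (fun t => om * y t - G t)); [reflexivity |].
      derive_from_context. unfold G. ring.
    - intros t Ht. specialize (Hx' t Ht). destruct (HK t Ht) as [Hx _].
      specialize (HL (x t)).
      eapply Rle_trans; [apply Rabs_triang |].
      rewrite Rabs_Ropp, !Rabs_mult, Rabs_Ropp, (Rabs_pos_eq om) by lra.
      apply Rplus_le_compat; [| apply Rmult_le_compat; auto using Rabs_pos].
      rewrite Rmult_assoc. repeat apply Rmult_le_compat_l; lra. }
  assert (Hc : 0 < Rmin (x 0 ^ 2 + y 0 ^ 2) (a ^ 2)).
  { specialize (Hpos 0 (Rle_refl 0)). apply Rmin_glb_lt; nra. }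
  set (c := Rmin _ _) in *.
  set (d := Rmin 1 (c / 2)).
  assert (Hd : 0 < d) by (apply Rmin_glb_lt; lra).
  assert (Hd1 : d <= 1) by apply Rmin_l. assert (Hd2 : d <= c / 2) by apply Rmin_r.
  set (e := om * d / (2 * (L + om + 1))).
  assert (He : 0 < e) by (apply Rdiv_lt_0_compat; nra).
  assert (HeL : (L + om + 1) * e = om * d / 2) by (unfold e; field; lra).
  destruct (proj1 (is_lim_p_infty_eps _ _) Hlx e He) as [T1 HT1].
  destruct (proj1 (is_lim_p_infty_eps _ _) Hlx' e He) as [T2 HT2].
  set (t := Rmax 0 (Rmax T1 T2) + 1).
  assert (Ht : 0 <= t /\ T1 < t /\ T2 < t).
  { unfold t. pose proof (Rmax_l 0 (Rmax T1 T2)). pose proof (Rmax_r 0 (Rmax T1 T2)).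
    pose proof (Rmax_l T1 T2). pose proof (Rmax_r T1 T2). lra. }
  specialize (HT1 t ltac:(lra)). specialize (HT2 t ltac:(lra)).
  rewrite Rminus_0_r in HT1, HT2.
  assert (HFx := friction_linear_bound (x t)).
  assert (Hxd : Rabs (x t) < d) by nra.
  assert (Hyd : Rabs (y t) < d).
  { assert (Hoy : Rabs (om * y t) < om * d).
    { replace (om * y t) with ((om * y t - F (x t)) + F (x t)) by ring.
      eapply Rle_lt_trans; [apply Rabs_triang |]. nra. }
    rewrite Rabs_mult, (Rabs_pos_eq om) in Hoy by lra. nra. }
  assert (Hlow := energy_lower_bound x y H t ltac:(lra)). fold c in Hlow.
  rewrite <- (pow2_abs (x t)), <- (pow2_abs (y t)) in Hlow.
  pose proof (Rabs_pos (x t)). pose proof (Rabs_pos (y t)). nra.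
Qed.

(** Without a further zero, [x] would keep a sign; by symmetry that sign is positive. *)
Lemma crosses_axis x y t0 : lienard x y -> exists t, t0 < t /\ x t = 0.
Proof.
  intros H. apply NNPP; intros Hn.
  assert (Hne : forall t, 0 <= t -> x (t + (t0 + 1)) <> 0).
  { intros t Ht Hx. apply Hn. exists (t + (t0 + 1)). split; [lra | auto]. }
  assert (Hs := lienard_shift x y (t0 + 1) H).
  destruct (Rlt_le_dec 0 (x (0 + (t0 + 1)))) as [Hp | Hp].
  - apply (no_positive_solution _ _ Hs). intros t Ht.
    apply (positive_of_nonvanishing (fun t => x (t + (t0 + 1)))); auto.
    + intros s. eexists; exact (proj1 (Hs s)).
    + intros s Hst. apply Hne. lra.
  - apply (no_positive_solution _ _ (lienard_opp _ _ Hs)). intros t Ht.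
    apply (positive_of_nonvanishing (fun t => - x (t + (t0 + 1)))); auto.
    + intros s. eexists; exact (proj1 (lienard_opp _ _ Hs s)).
    + specialize (Hne 0 (Rle_refl 0)). lra.
    + intros s Hst. specialize (Hne s ltac:(lra)). lra.
Qed.

(** * Polar form of a solution *)

Definition radius2 (x y : R -> R) (t : R) : R := x t ^ 2 + y t ^ 2.
(** The squared radius times the angular velocity, for angles measured clockwise from
    the positive [y] axis. *)
Definition rotation (x y : R -> R) (t : R) : R := om * radius2 x y t - F (x t) * y t.

Lemma rotation_derive x y t : lienard x y ->
  is_derive (rotation x y) t (om * x t * (x t * F1 (x t) - F (x t)) - F1 (x t) * rotation x y t).
Proof.
  intros H. destruct (H t) as [H1 H2].
  assert (H3 : is_derive (fun t => F (x t)) t ((om * y t - F (x t)) * F1 (x t))).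
  { apply (is_derive_comp F x); auto. }
  unfold rotation, radius2. set (G := fun t => F (x t)) in *.
  apply (is_derive_ext (fun t => om * (x t ^ 2 + y t ^ 2) - G t * y t)); [reflexivity |].
  derive_from_context. unfold G. ring.
Qed.

(** The derivative of [rotation] is a nonnegative term minus [F1 (x t)] times
    [rotation]; the integrating factor [exp] of the integral of [F1 (x t)] therefore
    makes [rotation] nondecreasing. *)
Lemma rotation_pos x y : lienard x y -> 0 < rotation x y 0 ->
  forall t, 0 <= t -> 0 < rotation x y t.
Proof.
  intros H H0 t Ht.
  set (I := fun t => 0 + RInt (fun s => F1 (x s)) 0 t).
  assert (HI : forall s, is_derive I s (F1 (x s))).
  { apply is_derive_integral. intros s. apply continuous_comp; [| auto].
    apply @ex_derive_continuous. eexists; exact (proj1 (H s)). }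
  assert (Hmon : rotation x y 0 * exp (I 0) <= rotation x y t * exp (I t)).
  { apply (nondecreasing_of_derive (fun s => rotation x y s * exp (I s))
      (fun s => om * x s * (x s * F1 (x s) - F (x s)) * exp (I s))); auto.
    - intros s _. assert (Hr := rotation_derive x y s H). specialize (HI s).
      set (W := rotation x y) in *. clearbody W I. derive_from_context. ring.
    - intros s _. pose proof (ratio_deriv_ge0 (x s)). pose proof (exp_pos (I s)).
      rewrite (Rmult_assoc om). apply Rmult_le_pos; nra. }
  pose proof (exp_pos (I 0)). pose proof (exp_pos (I t)). nra.
Qed.

(** The polar form of the system with the angle [s] as independent variable and the
    logarithm [e] of the radius as unknown, on the region where solutions turn
    clockwise. The logarithm is what makes the equation dissipative. *)
Definition profile (e : R -> R) : Prop :=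
  forall s, 0 <= s ->
    let r := exp (e s) in
    let N := F (r * sin s) in
    0 < om * r - N * cos s /\
    is_derive e s (- (N * sin s) / (om * r - N * cos s)).

(** The angle [th] is the integral of the angular velocity, and [e] is the logarithmic
    radius composed with the inverse of [th]. The angle is unbounded because between
    two crossings of the axis [x = 0] it advances to the next multiple of [PI]. *)
Lemma polar_form x y : lienard x y -> x 0 = 0 -> 0 < y 0 ->
  exists th e : R -> R,
    profile e /\ e 0 = ln (y 0) /\ (exists B, forall s, 0 <= s -> Rabs (e s) <= B) /\
    (forall t, 0 <= t -> 0 <= th t /\
       x t = exp (e (th t)) * sin (th t) /\ y t = exp (e (th t)) * cos (th t)) /\
    (forall s, 0 <= s -> exists t, 0 <= t /\ th t = s) /\
    (forall s, exists T, 0 <= T /\ forall t, T < t -> s < th t).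
Proof.
  intros H Hx0 Hy0.
  assert (Hnz : (x 0, y 0) <> (0, 0)) by (intros Heq; injection Heq; lra).
  assert (Hr := lienard_nonzero x y 0 H Hnz).
  assert (Hxd : forall t, is_derive x t (om * y t - F (x t))) by apply H.
  assert (Hyd : forall t, is_derive y t (- om * x t)) by apply H.
  assert (HW : forall t, 0 <= t -> 0 < rotation x y t).
  { apply rotation_pos; auto. unfold rotation, radius2. rewrite Hx0, friction_0.
    replace (om * (0 ^ 2 + y 0 ^ 2) - 0 * y 0) with (om * (y 0 * y 0)) by ring.
    repeat apply Rmult_lt_0_compat; auto. }
  set (rho := fun t => ln (x t ^ 2 + y t ^ 2) / 2).
  assert (Hrho : forall t, is_derive rho t (- (x t * F (x t)) / (x t ^ 2 + y t ^ 2))).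
  { intros t. specialize (Hr t). assert (He := energy_derive x y t H). unfold rho.
    set (E := fun t => x t ^ 2 + y t ^ 2) in *.
    apply (is_derive_ext (fun t => ln (E t) / 2)); [reflexivity |].
    change (is_derive E t (- (2 * (x t * F (x t))))) in He.
    change (x t ^ 2 + y t ^ 2) with (E t) in *. clearbody E.
    auto_derive; [repeat split; [eexists; eassumption | auto] |].
    change (Derive (fun x => E x) t) with (Derive E t).
    rewrite (is_derive_unique _ _ _ He). field. lra. }
  assert (Hexp : forall t, exp (rho t) ^ 2 = x t ^ 2 + y t ^ 2).
  { intros t. specialize (Hr t). simpl. rewrite Rmult_1_r, <- exp_plus. unfold rho.
    replace (ln (x t ^ 2 + y t ^ 2) / 2 + ln (x t ^ 2 + y t ^ 2) / 2)
      with (ln (x t ^ 2 + y t ^ 2)) by field.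
    rewrite exp_ln; auto; ring. }
  set (w := fun t => rotation x y t / radius2 x y t).
  assert (Hw : forall t, 0 <= t -> 0 < w t).
  { intros t Ht. apply Rdiv_lt_0_compat; [auto | apply Hr]. }
  assert (Hwc : forall t, continuous w t).
  { intros t. assert (H1 := Hxd t). assert (H2 := Hyd t). assert (H3 := Hr t).
    assert (Hd := rotation_derive x y t H). unfold w, radius2.
    apply @ex_derive_continuous.
    set (W := rotation x y) in *. clearbody W.
    auto_derive. repeat split; try (eexists; eassumption). nra. }
  (* Freezing the angular velocity at negative times makes the angle a bijection of
     the line, so that its inverse is differentiable at 0 as well. *)
  set (wp := fun t => w (Rmax t 0)).
  assert (Hwp : forall t, 0 < wp t) by (intros t; apply Hw, Rmax_r).
  assert (Hwpc : forall t, continuous wp t).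
  { intros t. apply (continuous_comp (fun t => Rmax t 0) w); [| apply Hwc].
    apply filterlim_locally. intros eps. exists eps. intros s Hs.
    change (Rabs (Rmax s 0 - Rmax t 0) < eps). change (Rabs (s - t) < eps) in Hs.
    eapply Rle_lt_trans; [| exact Hs].
    pose proof (Rle_abs (s - t)). pose proof (Rle_abs (- (s - t))). rewrite Rabs_Ropp in *.
    pose proof (Rabs_pos (s - t)).
    apply Rabs_le. unfold Rmax. destruct (Rle_dec s 0), (Rle_dec t 0); lra. }
  set (th := fun t => 0 + RInt wp 0 t).
  assert (Hth : forall t, is_derive th t (wp t)) by (apply is_derive_integral; auto).
  assert (Hthw : forall t, 0 <= t -> is_derive th t (w t)).
  { intros t Ht. replace (w t) with (wp t); auto. unfold wp. rewrite Rmax_left; auto. }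
  assert (Hth0 : th 0 = 0) by (unfold th; rewrite RInt_point; apply Rplus_0_r).
  assert (Hinc := strictly_increasing_of_derive th wp Hth Hwp).
  assert (Hinc' : forall s t, s <= t -> th s <= th t).
  { intros s t [Hst | ->]; [left; auto | lra]. }
  clearbody th.
  (* The unit vector of [(x, y)], turned back by the angle [th], has derivative 0. *)
  assert (Hrot : forall t, 0 <= t ->
    x t * cos (th t) - y t * sin (th t) = 0 /\
    x t * sin (th t) + y t * cos (th t) = exp (rho t)).
  { assert (Hp : forall t, 0 <= t -> is_derive
      (fun t => (x t * cos (th t) - y t * sin (th t)) * exp (- rho t)) t 0 /\ is_derive
      (fun t => (x t * sin (th t) + y t * cos (th t)) * exp (- rho t)) t 0).
    { intros t Ht. assert (H1 := Hxd t). assert (H2 := Hyd t). assert (H3 := Hr t).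
      assert (H4 := Hthw t Ht). assert (H5 := Hrho t). clearbody rho.
      split; derive_from_context; unfold w, rotation, radius2; field; lra. }
    assert (Hrho0 : exp (rho 0) = y 0).
    { specialize (Hexp 0). rewrite Hx0 in Hexp. pose proof (exp_pos (rho 0)). nra. }
    intros t Ht.
    assert (Hi : Rmin 0 t = 0 /\ Rmax 0 t = t)
      by (split; [apply Rmin_left | apply Rmax_right]; auto).
    destruct Hi as [Hi1 Hi2].
    assert (C1 := constant_of_derive
      (fun t => (x t * cos (th t) - y t * sin (th t)) * exp (- rho t)) 0 t).
    assert (C2 := constant_of_derive
      (fun t => (x t * sin (th t) + y t * cos (th t)) * exp (- rho t)) 0 t).
    cbv beta in C1, C2. rewrite Hi1, Hi2 in C1, C2.
    specialize (C1 (fun s Hs => proj1 (Hp s (proj1 Hs)))).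
    specialize (C2 (fun s Hs => proj2 (Hp s (proj1 Hs)))).
    rewrite Hth0, Hx0, cos_0, sin_0, !exp_Ropp, Hrho0 in C1, C2.
    pose proof (exp_pos (rho t)). split.
    - apply (Rmult_eq_reg_r (/ exp (rho t))); [| apply Rinv_neq_0_compat; lra].
      rewrite <- C1. ring.
    - apply (Rmult_eq_reg_r (/ exp (rho t))); [| apply Rinv_neq_0_compat; lra].
      rewrite <- C2. field. lra. }
  assert (Hpol : forall t, 0 <= t ->
    x t = exp (rho t) * sin (th t) /\ y t = exp (rho t) * cos (th t)).
  { intros t Ht. destruct (Hrot t Ht) as [E1 E2].
    pose proof (sin2_cos2 (th t)) as Hsc. unfold Rsqr in Hsc.
    rewrite <- E2. split.
    - transitivity (x t * (sin (th t) * sin (th t) + cos (th t) * cos (th t))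
        - cos (th t) * (x t * cos (th t) - y t * sin (th t))); [rewrite Hsc, E1 |]; ring.
    - transitivity (y t * (sin (th t) * sin (th t) + cos (th t) * cos (th t))
        + sin (th t) * (x t * cos (th t) - y t * sin (th t))); [rewrite Hsc, E1 |]; ring. }
  assert (Hunb : forall n : nat, exists t, 0 <= t /\ INR n * PI <= th t).
  { induction n as [| n (t & Ht & Hn)].
    - exists 0. rewrite Hth0. simpl. lra.
    - destruct (crosses_axis x y t H) as (t' & Ht' & Hx').
      exists t'. split; [lra |].
      assert (Hlt := Hinc t t' Ht').
      destruct (Hpol t' ltac:(lra)) as [Hs _]. rewrite Hx' in Hs.
      pose proof (exp_pos (rho t')).
      destruct (sin_eq_0_0 (th t')) as [k Hk]; [nra |].
      pose proof PI_RGT_0.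
      assert (Hk' : INR n < IZR k) by nra.
      rewrite INR_IZR_INZ in Hk'. apply lt_IZR in Hk'.
      assert (Hle : (Z.of_nat (S n) <= k)%Z) by lia.
      apply IZR_le in Hle. rewrite <- INR_IZR_INZ in Hle. rewrite Hk.
      apply Rmult_le_compat_r; lra. }
  assert (Hunb' : forall s, exists t, 0 <= t /\ s <= th t).
  { intros s. destruct (INR_unbounded (s / PI)) as [n Hn].
    destruct (Hunb n) as (t & Ht & Hle). exists t. split; auto.
    pose proof PI_RGT_0. apply (Rmult_lt_compat_r PI) in Hn; auto.
    unfold Rdiv in Hn. rewrite Rmult_assoc, Rinv_l, Rmult_1_r in Hn; lra. }
  assert (Hback : forall t, t <= 0 -> th t = w 0 * t).
  { intros t Ht.
    assert (C := constant_of_derive (fun t => th t - w 0 * t) t 0).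
    cbv beta in C. rewrite Hth0, Rmult_0_r in C. enough (th t - w 0 * t = 0 - 0) by lra.
    apply C. rewrite Rmin_left, Rmax_right by auto. intros s Hs.
    assert (Hd := Hth s). unfold wp in Hd. rewrite Rmax_right in Hd by lra.
    derive_from_context. ring. }
  assert (Hsurj : forall s, exists t, th t = s).
  { intros s. assert (H0 := Hw 0 (Rle_refl 0)). destruct (Rle_lt_dec 0 s) as [Hs | Hs].
    - destruct (Hunb' s) as (t & Ht & Hle).
      destruct (IVT_gen th 0 t s) as (u & _ & Hu); [| | exists u; auto].
      + intros u. apply continuity_pt_filterlim, @ex_derive_continuous. eexists; apply Hth.
      + rewrite Hth0, Rmin_left, Rmax_right by lra. lra.
    - exists (s / w 0). rewrite Hback; [field; lra |].
      apply Rmult_le_reg_r with (w 0); auto. unfold Rdiv.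
      rewrite Rmult_assoc, Rinv_l; lra. }
  destruct (inverse_derivable th wp Hth Hwp Hsurj) as (g & Hg1 & Hg2 & Hg).
  assert (Hgpos : forall s, 0 <= s -> 0 <= g s).
  { intros s Hs. apply Rnot_lt_le; intros Hlt. apply Hinc in Hlt.
    rewrite Hg1, Hth0 in Hlt. lra. }
  exists th, (fun s => rho (g s)).
  split; [| split; [| split; [| split; [| split]]]].
  - intros s Hs. cbv zeta. specialize (Hgpos s Hs). destruct (Hpol _ Hgpos) as [Ex Ey].
    rewrite Hg1 in Ex, Ey. rewrite <- Ex.
    assert (Hwg := Hw _ Hgpos). unfold w, rotation, radius2 in Hwg.
    assert (Hpe := exp_pos (rho (g s))).
    assert (Hq : (om * (x (g s) ^ 2 + y (g s) ^ 2) - F (x (g s)) * y (g s))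
      / (x (g s) ^ 2 + y (g s) ^ 2)
      = (om * exp (rho (g s)) - F (x (g s)) * cos s) / exp (rho (g s))).
    { rewrite <- Hexp. rewrite Ey. field. lra. }
    rewrite Hq in Hwg. split.
    + apply Rmult_lt_reg_r with (/ exp (rho (g s))); [apply Rinv_0_lt_compat; auto |].
      rewrite Rmult_0_l. exact Hwg.
    + assert (Hnum : 0 < om * exp (rho (g s)) - F (x (g s)) * cos s).
      { apply Rmult_lt_reg_r with (/ exp (rho (g s))); [apply Rinv_0_lt_compat; auto |].
        rewrite Rmult_0_l. exact Hwg. }
      evar_last; [apply (is_derive_comp rho g); [apply Hrho | apply Hg] |].
      match goal with |- scal ?p ?q = _ => change (scal p q) with (p * q) end.
      unfold wp. rewrite Rmax_left by auto.
      unfold w, rotation, radius2. rewrite Hq, <- Hexp. 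
      replace (x (g s) * F (x (g s))) with (exp (rho (g s)) * sin s * F (x (g s)))
        by (rewrite <- Ex; reflexivity).
      field. lra.
  - assert (Hg0 := Hg2 0). rewrite Hth0 in Hg0. rewrite Hg0.
    rewrite <- (ln_exp (rho 0)). f_equal. specialize (Hexp 0).
    rewrite Hx0 in Hexp. pose proof (exp_pos (rho 0)). nra.
  - destruct (Hbounded x y H) as [M HM].
    set (m := Rmin (x 0 ^ 2 + y 0 ^ 2) (a ^ 2)).
    assert (Hm : 0 < m) by (apply Rmin_glb_lt; [apply Hr | nra]).
    exists (Rabs (ln m) + Rabs (ln M)). intros s Hs. specialize (Hgpos s Hs).
    assert (H1 := energy_lower_bound x y H _ Hgpos). fold m in H1.
    assert (H2 := HM _ Hgpos). unfold rho.
    assert (Hl1 : ln m <= ln (x (g s) ^ 2 + y (g s) ^ 2)).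
    { destruct H1 as [H1 | <-]; [left; apply ln_increasing; auto | lra]. }
    assert (Hl2 : ln (x (g s) ^ 2 + y (g s) ^ 2) <= ln M).
    { destruct H2 as [H2 | ->]; [left; apply ln_increasing; auto; lra | lra]. }
    pose proof (Rle_abs (ln M)). pose proof (Rle_abs (- ln m)). rewrite Rabs_Ropp in *.
    pose proof (Rabs_pos (ln m)). pose proof (Rabs_pos (ln M)). apply Rabs_le. lra.
  - intros t Ht. rewrite Hg2. split; [rewrite <- Hth0; auto | auto].
  - intros s Hs. exists (g s). auto.
  - intros s. destruct (Hunb' s) as (T & HT & Hle). exists T. split; auto.
    intros t Ht. apply Hinc in Ht. lra.
Qed.

(** * Profiles: logarithmic radius as a function of the angle *)

Lemma ratio_increasing u v : 0 < u -> u < v -> F u * v < F v * u.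
Proof.
  intros Hu Huv.
  assert (H : F u / u < F v / v).
  { apply (increasing_of_derive (fun t => F t / t) (fun t => (t * F1 t - F t) / t ^ 2)); auto.
    - intros t Ht. assert (Hd := HF t). derive_from_context; [lra |]. field. lra.
    - intros t Ht. specialize (Hratio t ltac:(lra)). apply Rdiv_lt_0_compat; [lra |].
      apply pow_lt. lra. }
  apply (Rmult_lt_compat_r (u * v)) in H; [| nra].
  replace (F u / u * (u * v)) with (F u * v) in H by (field; lra).
  replace (F v / v * (u * v)) with (F v * u) in H by (field; lra).
  exact H.
Qed.

(** Up to the positive factor [r1 r2], this is the growth with [r] of
    [c F (r c) / r], the product of [F x / x] at [x = r c] with [c ^ 2]. *)
Lemma ray_increasing r1 r2 c : 0 < r2 -> r2 < r1 -> c <> 0 ->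
  0 < c * (F (r1 * c) * r2 - F (r2 * c) * r1).
Proof.
  intros H2 H21 Hc.
  assert (Hpos : forall c, 0 < c -> 0 < c * (F (r1 * c) * r2 - F (r2 * c) * r1)).
  { intros k Hk. assert (H := ratio_increasing (r2 * k) (r1 * k) ltac:(nra) ltac:(nra)). lra. }
  destruct (Rtotal_order c 0) as [Hc' | [? | Hc']]; [| contradiction | auto].
  specialize (Hpos (- c) ltac:(lra)).
  replace (r1 * - c) with (- (r1 * c)) in Hpos by ring.
  replace (r2 * - c) with (- (r2 * c)) in Hpos by ring.
  rewrite !Hodd in Hpos. lra.
Qed.

Definition slope (e : R -> R) (s : R) : R :=
  - (F (exp (e s) * sin s) * sin s) / (om * exp (e s) - F (exp (e s) * sin s) * cos s).

Lemma profile_derive e s : profile e -> 0 <= s -> is_derive e s (slope e s).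
Proof. intros H Hs. apply (H s Hs). Qed.

(** Farther out on a ray the ratio [F x / x] is larger, and the slope decreases with
    this ratio: the polar equation, in logarithmic radius, is dissipative. *)
Lemma slope_antitone e1 e2 s : profile e1 -> profile e2 -> 0 <= s -> e2 s <= e1 s ->
  slope e1 s <= slope e2 s /\ (sin s <> 0 -> e2 s < e1 s -> slope e1 s < slope e2 s).
Proof.
  intros H1 H2 Hs He. destruct (H1 s Hs) as [D1 _]. destruct (H2 s Hs) as [D2 _].
  assert (P2 := exp_pos (e2 s)).
  assert (Hslope : slope e2 s - slope e1 s =
    om * (sin s * (F (exp (e1 s) * sin s) * exp (e2 s) - F (exp (e2 s) * sin s) * exp (e1 s)))
    / ((om * exp (e1 s) - F (exp (e1 s) * sin s) * cos s)
       * (om * exp (e2 s) - F (exp (e2 s) * sin s) * cos s))).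
  { unfold slope. field. lra. }
  assert (Hprod := Rmult_lt_0_compat _ _ D1 D2).
  assert (Hstrict : sin s <> 0 -> e2 s < e1 s -> 0 < slope e2 s - slope e1 s).
  { intros Hsin Hlt. rewrite Hslope. apply Rdiv_lt_0_compat; [| exact Hprod].
    apply Rmult_lt_0_compat; [exact Hom |].
    apply ray_increasing; auto. apply exp_increasing; auto. }
  split.
  - destruct (Req_dec (sin s) 0) as [H0 | H0].
    { enough (0 = slope e2 s - slope e1 s) by lra.
      rewrite Hslope, H0. field. rewrite H0, !Rmult_0_r, friction_0 in *. lra. }
    destruct He as [Hlt | Heq]; [specialize (Hstrict H0 Hlt); lra |].
    unfold slope. rewrite Heq. lra.
  - intros Hsin Hlt. specialize (Hstrict Hsin Hlt). lra.
Qed.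

(** Where the order is violated, the slopes act to restore it. *)
Lemma profile_order e1 e2 : profile e1 -> profile e2 -> e1 0 <= e2 0 ->
  forall s, 0 <= s -> e1 s <= e2 s.
Proof.
  intros H1 H2 H0 s Hs. enough (0 <= e2 s - e1 s) by lra.
  apply (lower_barrier (fun s => e2 s - e1 s) (fun s => slope e2 s - slope e1 s)); auto; try lra.
  - intros t Ht. assert (D1 := profile_derive e1 t H1 Ht).
    assert (D2 := profile_derive e2 t H2 Ht). derive_from_context. ring.
  - intros t Ht Hlt. destruct (slope_antitone e1 e2 t H1 H2 Ht) as [H _]; lra.
Qed.

Lemma gap_derive e1 e2 s : profile e1 -> profile e2 -> 0 <= s ->
  is_derive (fun s => (e1 s - e2 s) ^ 2) s (2 * (e1 s - e2 s) * (slope e1 s - slope e2 s)).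
Proof.
  intros H1 H2 Hs. assert (D1 := profile_derive e1 s H1 Hs).
  assert (D2 := profile_derive e2 s H2 Hs). derive_from_context. ring.
Qed.

Lemma gap_derive_sign e1 e2 s : profile e1 -> profile e2 -> 0 <= s ->
  2 * (e1 s - e2 s) * (slope e1 s - slope e2 s) <= 0 /\
  (sin s <> 0 -> e1 s <> e2 s -> 2 * (e1 s - e2 s) * (slope e1 s - slope e2 s) < 0).
Proof.
  intros H1 H2 Hs. destruct (Rle_lt_dec (e2 s) (e1 s)) as [Hle | Hlt].
  - destruct (slope_antitone e1 e2 s H1 H2 Hs Hle) as [Ha1 Ha2]. split; [nra |].
    intros Hsin Hne. specialize (Ha2 Hsin ltac:(lra)). nra.
  - destruct (slope_antitone e2 e1 s H2 H1 Hs ltac:(lra)) as [Ha1 Ha2]. split; [nra |].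
    intros Hsin Hne. specialize (Ha2 Hsin Hlt). nra.
Qed.

Lemma gap_nonincreasing e1 e2 s t : profile e1 -> profile e2 -> 0 <= s -> s <= t ->
  Rabs (e1 t - e2 t) <= Rabs (e1 s - e2 s).
Proof.
  intros H1 H2 Hs Hst. apply Rsqr_le_abs_0. rewrite !Rsqr_pow2.
  apply (nonincreasing_of_derive (fun s => (e1 s - e2 s) ^ 2)
    (fun s => 2 * (e1 s - e2 s) * (slope e1 s - slope e2 s))); auto.
  - intros u Hu. apply gap_derive; auto; lra.
  - intros u Hu. apply gap_derive_sign; auto; lra.
Qed.

Lemma profile_half_turn e : profile e -> profile (fun s => e (s + PI)).
Proof.
  intros H s Hs. pose proof PI_RGT_0. destruct (H (s + PI) ltac:(lra)) as [D1 D2].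
  cbv zeta. rewrite neg_sin, neg_cos in D1, D2.
  replace (exp (e (s + PI)) * - sin s) with (- (exp (e (s + PI)) * sin s)) in D1, D2 by ring.
  rewrite Hodd in D1, D2. split; [lra |].
  assert (Hc : is_derive (fun s => s + PI) s 1) by (auto_derive; auto; ring).
  evar_last; [apply (is_derive_comp e (fun s => s + PI)); [exact D2 | exact Hc] |].
  match goal with |- scal ?p ?q = _ => change (scal p q) with (p * q) end.
  rewrite Rmult_1_l. f_equal; [ring | f_equal; ring].
Qed.

Lemma profile_half_turns e (n : nat) : profile e -> profile (fun s => e (s + INR n * PI)).
Proof.
  intros H. induction n as [| n IH].
  - intros s Hs. simpl INR. rewrite Rmult_0_l, Rplus_0_r. destruct (H s Hs) as [D1 D2].
    split; auto. apply (is_derive_ext e); [| auto]. intros u. f_equal.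
    symmetry. transitivity (u + 0); [f_equal; apply Rmult_0_l | apply Rplus_0_r].
  - apply profile_half_turn in IH. intros s Hs. destruct (IH s Hs) as [D1 D2].
    assert (Heq : forall u, u + PI + INR n * PI = u + INR (S n) * PI)
      by (intros u; rewrite S_INR; ring).
    rewrite Heq in D1, D2. split; auto.
    eapply is_derive_ext; [| exact D2]. intros u. cbv beta. f_equal. apply Heq.
Qed.

Definition half_periodic (e : R -> R) : Prop := forall s, 0 <= s -> e (s + PI) = e s.

Lemma half_periodic_iter e (n : nat) : half_periodic e ->
  forall s, 0 <= s -> e (s + INR n * PI) = e s.
Proof.
  intros H s Hs. pose proof PI_RGT_0. induction n as [| n IH].
  - f_equal. simpl. ring.
  - rewrite <- IH, S_INR.
    replace (s + (INR n + 1) * PI) with (s + INR n * PI + PI) by ring.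
    apply H. pose proof (pos_INR n). nra.
Qed.

(** A gap between the two would decrease strictly over the half turn, where
    [sin s > 0], yet have the same value at both ends. *)
Lemma half_periodic_unique e1 e2 :
  profile e1 -> profile e2 -> half_periodic e1 -> half_periodic e2 -> e1 0 = e2 0.
Proof.
  intros H1 H2 P1 P2. pose proof PI_RGT_0. apply NNPP; intros Hne.
  specialize (P1 0 (Rle_refl 0)). specialize (P2 0 (Rle_refl 0)). rewrite Rplus_0_l in P1, P2.
  assert (Hlt : - (e1 0 - e2 0) ^ 2 < - (e1 PI - e2 PI) ^ 2).
  { apply (increasing_of_derive (fun s => - (e1 s - e2 s) ^ 2)
      (fun s => - (2 * (e1 s - e2 s) * (slope e1 s - slope e2 s)))); auto.
    - intros s Hs. assert (D := gap_derive e1 e2 s H1 H2 ltac:(lra)).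
      apply (is_derive_opp _ _ _ D).
    - intros s Hs. destruct (gap_derive_sign e1 e2 s H1 H2 ltac:(lra)) as [_ Hsg].
      enough (2 * (e1 s - e2 s) * (slope e1 s - slope e2 s) < 0) by lra. apply Hsg.
      + apply Rgt_not_eq, sin_gt_0; lra.
      + intros Heq. assert (Hg := gap_nonincreasing e1 e2 s PI H1 H2 ltac:(lra) ltac:(lra)).
        rewrite P1, P2, Heq, Rminus_diag, Rabs_R0 in Hg.
        pose proof (Rabs_pos_lt (e1 0 - e2 0) ltac:(lra)). lra. }
  rewrite P1, P2 in Hlt. lra.
Qed.

(** Order preservation makes the successive half-turn values monotone. *)
Lemma half_turns_converge e : profile e -> (exists B, forall s, 0 <= s -> Rabs (e s) <= B) ->
  exists l : R, is_lim_seq (fun n => e (INR n * PI)) l.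
Proof.
  intros H [B HB]. pose proof PI_RGT_0.
  assert (Hn : forall n, 0 <= INR n * PI) by (intros n; pose proof (pos_INR n); nra).
  assert (Hsh := profile_half_turn e H).
  assert (HS : forall n, e (INR (S n) * PI) = e (INR n * PI + PI)).
  { intros n. f_equal. rewrite S_INR. ring. }
  destruct (Rle_lt_dec (e 0) (e (0 + PI))) as [Hle | Hlt].
  - destruct (ex_finite_lim_seq_incr (fun n => e (INR n * PI)) B) as [l Hl].
    + intros n. rewrite HS. apply (profile_order e (fun s => e (s + PI))); auto.
    + intros n. specialize (HB _ (Hn n)). apply Rabs_le_between in HB. lra.
    + exists l; auto.
  - destruct (ex_finite_lim_seq_decr (fun n => e (INR n * PI)) (- B)) as [l Hl].
    + intros n. rewrite HS. apply (profile_order (fun s => e (s + PI)) e); auto. lra.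
    + intros n. specialize (HB _ (Hn n)). apply Rabs_le_between in HB. lra.
    + exists l; auto.
Qed.

(** After [N] half turns [e] is close to [l], where [e'] starts. Over the next half turn
    the gap does not grow, so [e' PI] is as close to the next value of [e], and that
    is close to [l] too. *)
Lemma half_periodic_of_limit e e' (l : R) : profile e -> profile e' ->
  is_lim_seq (fun n => e (INR n * PI)) l -> e' 0 = l -> half_periodic e'.
Proof.
  intros H H' Hl H0. pose proof PI_RGT_0.
  assert (HPI : e' PI = l).
  { apply NNPP; intros Hne.
    assert (Hpos : 0 < Rabs (e' PI - l) / 2).
    { apply Rdiv_lt_0_compat; [apply Rabs_pos_lt; lra | lra]. }
    destruct (proj2 (is_lim_seq_spec _ _) Hl (mkposreal _ Hpos)) as [N HN]. simpl in HN.
    assert (HN1 := HN N (le_n N)). assert (HN2 := HN (S N) (le_S _ _ (le_n N))).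
    assert (Hg := gap_nonincreasing e' (fun s => e (s + INR N * PI)) 0 PI H'
      (profile_half_turns e N H) (Rle_refl 0) ltac:(lra)).
    cbv beta in Hg. rewrite Rplus_0_l, H0, (Rabs_minus_sym l) in Hg.
    replace (PI + INR N * PI) with (INR (S N) * PI) in Hg by (rewrite S_INR; ring).
    assert (Htri : Rabs (e' PI - l) <=
      Rabs (e' PI - e (INR (S N) * PI)) + Rabs (e (INR (S N) * PI) - l)).
    { eapply Rle_trans; [| apply Rabs_triang]. right. f_equal. ring. }
    lra. }
  intros s Hs.
  assert (Hg := gap_nonincreasing _ _ 0 s (profile_half_turn e' H') H' (Rle_refl 0) Hs).
  cbv beta in Hg.
  rewrite Rplus_0_l, HPI, H0, Rminus_diag, Rabs_R0 in Hg.
  pose proof (Rabs_pos (e' (s + PI) - e' s)).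
  apply Rminus_diag_uniq. apply Rabs_eq_0. lra.
Qed.

Lemma orbit_from_axis (l : R) : exists x y th e,
  lienard x y /\ x 0 = 0 /\ y 0 = exp l /\
  profile e /\ e 0 = l /\ (exists B, forall s, 0 <= s -> Rabs (e s) <= B) /\
  (forall s, 0 <= s -> exists t, 0 <= t /\ th t = s) /\
  (forall t, 0 <= t -> 0 <= th t /\
     x t = exp (e (th t)) * sin (th t) /\ y t = exp (e (th t)) * cos (th t)).
Proof.
  destruct (lienard_exists 0 (exp l)) as (x & y & H & Hx & Hy).
  pose proof (exp_pos l).
  destruct (polar_form x y H Hx ltac:(lra)) as (th & e & He & He0 & HB & Hp & Hs & _).
  exists x, y, th, e. rewrite Hy, ln_exp in He0. auto 10.
Qed.

(** The values of [e] after half turns converge to the starting value of some half-turn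
    invariant profile, which is [eh] by uniqueness; from then on the gap cannot grow. *)
Lemma profile_attracted e eh : profile eh -> half_periodic eh ->
  profile e -> (exists B, forall s, 0 <= s -> Rabs (e s) <= B) ->
  forall eps, 0 < eps -> exists S, 0 <= S /\ forall s, S <= s -> Rabs (e s - eh s) < eps.
Proof.
  intros Hh Ph H HB eps Heps. pose proof PI_RGT_0.
  destruct (half_turns_converge e H HB) as [l Hl].
  assert (Hhl : eh 0 = l).
  { destruct (orbit_from_axis l) as (x & y & th & e' & _ & _ & _ & He' & He0 & _).
    rewrite <- He0. apply half_periodic_unique; auto.
    apply (half_periodic_of_limit e e' l); auto. }
  destruct (proj2 (is_lim_seq_spec _ _) Hl (mkposreal _ Heps)) as [N HN].
  specialize (HN N (le_n N)). simpl pos in HN.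
  assert (HN0 : 0 <= INR N * PI) by (pose proof (pos_INR N); nra).
  exists (INR N * PI). split; auto. intros s Hs.
  eapply Rle_lt_trans; [apply (gap_nonincreasing e eh (INR N * PI) s); auto |].
  assert (Hp := half_periodic_iter eh N Ph 0 (Rle_refl 0)). rewrite Rplus_0_l in Hp.
  rewrite Hp, Hhl. exact HN.
Qed.

(** If the first crossing is on the negative [y] axis, a half turn of the opposite
    solution leads to the positive one. *)
Lemma reaches_positive_axis x y : lienard x y -> (x 0, y 0) <> (0, 0) ->
  exists t, 0 <= t /\ x t = 0 /\ 0 < y t.
Proof.
  intros H H0. destruct (crosses_axis x y 0 H) as (t1 & Ht1 & Hx1).
  assert (Hr := lienard_nonzero x y 0 H H0 t1). rewrite Hx1 in Hr.
  destruct (Rlt_le_dec 0 (y t1)) as [Hy | Hy]; [exists t1; split; [lra | auto] |].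
  assert (Hy' : y t1 < 0).
  { destruct Hy as [Hy | Hy]; auto. rewrite Hy in Hr. lra. }
  assert (Hs := lienard_opp _ _ (lienard_shift x y t1 H)).
  destruct (polar_form _ _ Hs) as (th & e & _ & _ & _ & Hp & Hsurj & _).
  - rewrite Rplus_0_l, Hx1. ring.
  - rewrite Rplus_0_l. lra.
  - destruct (Hsurj PI) as (t & Ht & Hth); [pose proof PI_RGT_0; lra |].
    destruct (Hp t Ht) as (_ & Ex & Ey). rewrite Hth, sin_PI in Ex. rewrite Hth, cos_PI in Ey.
    pose proof (exp_pos (e PI)).
    exists (t + t1). split; [lra |]. split; lra.
Qed.

(** [X, Y] is the solution whose profile is half-turn invariant and [T] the time of its
    half turn; oddness and uniqueness give the antiperiodicity. Points at the same
    angle are compared for the attraction. A periodic solution returns to its starting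
    point on the axis, while its profile approaches the invariant one at the same
    multiples of [PI], so it starts on the cycle. *)
Theorem lienard_limit_cycle : exists (X Y : R -> R) (T : R),
  lienard X Y /\ 0 < T /\ 0 < Y 0 /\
  (forall t, X (t + T) = - X t /\ Y (t + T) = - Y t) /\
  (forall x y, lienard x y -> (x 0, y 0) <> (0, 0) ->
    forall eps, 0 < eps -> exists T0, forall t, T0 < t ->
    exists s, Rabs (x t - X s) < eps /\ Rabs (y t - Y s) < eps) /\
  (forall x y P, lienard x y -> (x 0, y 0) <> (0, 0) -> 0 < P ->
    (forall t, x (t + P) = x t /\ y (t + P) = y t) ->
    exists c, forall t, x t = X (t + c) /\ y t = Y (t + c)).
Proof.
  pose proof PI_RGT_0.
  destruct (orbit_from_axis 0) as (x1 & y1 & th1 & e1 & _ & _ & _ & He1 & _ & HB1 & _ & _).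
  destruct (half_turns_converge e1 He1 HB1) as [l Hl].
  destruct (orbit_from_axis l) as (X & Y & th & e & HXY & HX0 & HY0 & He & He0 & HB & Hsurj & Hp).
  assert (Hper := half_periodic_of_limit e1 e l He1 He Hl He0).
  destruct (Hsurj PI ltac:(lra)) as (T & HT & HthT).
  destruct (Hp T HT) as (_ & EX & EY).
  rewrite HthT in EX, EY. rewrite sin_PI in EX. rewrite cos_PI in EY.
  assert (HePI : e PI = l).
  { rewrite <- He0, <- (Hper 0 (Rle_refl 0)). f_equal. ring. }
  rewrite HePI in EX, EY. assert (Hel := exp_pos l).
  assert (Hnear : forall x y, lienard x y -> x 0 = 0 -> 0 < y 0 ->
    exists th' e', profile e' /\ (forall eps, 0 < eps -> exists S, 0 <= S /\
        forall s, S <= s -> Rabs (e' s - e s) < eps) /\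
      (forall t, 0 <= t -> 0 <= th' t /\
       x t = exp (e' (th' t)) * sin (th' t) /\ y t = exp (e' (th' t)) * cos (th' t)) /\
      (forall s, exists T, 0 <= T /\ forall t, T < t -> s < th' t)).
  { intros x y H' Hx Hy.
    destruct (polar_form x y H' Hx Hy) as (th' & e' & He' & _ & HB' & Hp' & _ & Hinf).
    exists th', e'. split; [auto | split; [| auto]].
    apply profile_attracted; auto. }
  exists X, Y, T. split; [auto | split; [| split; [lra | split; [| split]]]].
  - destruct HT as [HT | <-]; auto. lra.
  - intros t.
    assert (Hu := lienard_unique _ _ _ _ 0 (lienard_shift X Y T HXY) (lienard_opp X Y HXY)).
    cbv beta in Hu. rewrite Rplus_0_l in Hu. apply Hu; lra.
  - intros x y H' H0 eps Heps.
    destruct (reaches_positive_axis x y H' H0) as (t0 & Ht0 & Hx0 & Hy0).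
    destruct (Hnear _ _ (lienard_shift x y t0 H')) as (th' & e' & He' & Hatt & Hp' & Hinf);
      [rewrite Rplus_0_l; auto .. |].
    destruct HB as [B HB].
    assert (HeB := exp_pos B).
    assert (Hcont : exists d, 0 < d /\ forall u, Rabs u < d -> exp B * Rabs (exp u - 1) < eps).
    { assert (Hc := derivable_continuous_pt exp 0 (derivable_pt_exp 0)).
      destruct (Hc (eps / exp B)) as (d & Hd & Hdd); [apply Rdiv_lt_0_compat; auto |].
      exists d. split; auto. intros u Hu.
      destruct (Req_dec u 0) as [-> | Hu0].
      { rewrite exp_0, Rminus_diag, Rabs_R0. lra. }
      specialize (Hdd u). simpl in Hdd. unfold Rdist, D_x, no_cond in Hdd.
      rewrite exp_0, Rminus_0_r in Hdd.
      specialize (Hdd (conj (conj I (not_eq_sym Hu0)) Hu)).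
      apply (Rmult_lt_compat_l (exp B)) in Hdd; auto.
      replace (exp B * (eps / exp B)) with eps in Hdd by (field; lra). exact Hdd. }
    destruct Hcont as (d & Hd & Hdd).
    destruct (Hatt d Hd) as (S & HS & Hgap). destruct (Hinf S) as (T1 & HT1 & Hbig).
    exists (T1 + t0). intros t Ht.
    set (s := th' (t - t0)).
    assert (Hs : S < s) by (apply Hbig; lra).
    destruct (Hp' (t - t0) ltac:(lra)) as (_ & Ex & Ey). fold s in Ex, Ey.
    replace (t - t0 + t0) with t in Ex, Ey by ring.
    destruct (Hsurj s ltac:(lra)) as (u & Hu & Hthu).
    destruct (Hp u Hu) as (_ & EX' & EY'). rewrite Hthu in EX', EY'.
    assert (Hr : Rabs (exp (e' s) - exp (e s)) < eps).
    { specialize (Hdd _ (Hgap s ltac:(lra))).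
      replace (exp (e' s) - exp (e s)) with (exp (e s) * (exp (e' s - e s) - 1)).
      2: { unfold Rminus. rewrite Rmult_plus_distr_l, <- exp_plus.
           replace (e s + (e' s + - e s)) with (e' s) by ring. ring. }
      rewrite Rabs_mult, (Rabs_pos_eq (exp (e s))) by (left; apply exp_pos).
      eapply Rle_lt_trans; [| exact Hdd]. apply Rmult_le_compat_r; [apply Rabs_pos |].
      assert (Hle : e s <= B).
      { specialize (HB s ltac:(lra)). apply Rabs_le_between in HB. lra. }
      destruct Hle as [Hle | ->]; [left; apply exp_increasing; auto | lra]. }
    exists u. rewrite Ex, Ey, EX', EY'.
    assert (Hmul : forall c, -1 <= c <= 1 ->
      Rabs (exp (e' s) * c - exp (e s) * c) < eps).
    { intros c Hc. rewrite <- Rmult_minus_distr_r, Rabs_mult.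
      assert (Rabs c <= 1) by (apply Rabs_le; lra).
      pose proof (Rabs_pos (exp (e' s) - exp (e s))). pose proof (Rabs_pos c). nra. }
    split; apply Hmul; [apply SIN_bound | apply COS_bound].
  - intros x y P H' H0 HP Hxy.
    destruct (reaches_positive_axis x y H' H0) as (t0 & Ht0 & Hx0 & Hy0).
    destruct (Hnear _ _ (lienard_shift x y t0 H')) as (th' & e' & He' & Hatt & Hp' & Hinf);
      [rewrite Rplus_0_l; auto .. |].
    assert (Hn : forall n t, x (t + INR n * P) = x t /\ y (t + INR n * P) = y t).
    { induction n as [| n IH]; intros t.
      - simpl INR. rewrite Rmult_0_l, Rplus_0_r. auto.
      - rewrite S_INR. replace (t + (INR n + 1) * P) with (t + INR n * P + P) by ring.
        destruct (Hxy (t + INR n * P)) as [-> ->]. apply IH. }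
    assert (Hy : y t0 = exp l).
    { rewrite <- (exp_ln (y t0)) by auto. f_equal.
      apply NNPP; intros Hne.
      assert (Hpos := Rabs_pos_lt (ln (y t0) - l) ltac:(lra)).
      destruct (Hatt _ Hpos) as (S & HS & Hgap). destruct (Hinf S) as (T1 & HT1 & Hbig).
      destruct (INR_unbounded (T1 / P)) as [n Hn1].
      assert (HnP : T1 < INR n * P).
      { apply (Rmult_lt_compat_r P) in Hn1; auto.
        unfold Rdiv in Hn1. rewrite Rmult_assoc, Rinv_l in Hn1; lra. }
      set (s := th' (INR n * P)).
      assert (Hs : S < s) by (apply Hbig; auto).
      destruct (Hp' (INR n * P) ltac:(lra)) as (Hs0 & Ex & Ey). fold s in Hs0, Ex, Ey.
      rewrite (Rplus_comm _ t0) in Ex, Ey. destruct (Hn n t0) as [Hnx Hny].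
      rewrite Hnx, Hx0 in Ex. rewrite Hny in Ey.
      assert (Hes := exp_pos (e' s)).
      assert (Hsin : sin s = 0) by nra.
      destruct (sin_eq_0_0 s Hsin) as [k Hk].
      assert (Hk0 : (0 <= k)%Z).
      { apply le_IZR. rewrite Hk in Hs0. nra. }
      assert (Hes' : e s = l).
      { rewrite Hk, <- (Z2Nat.id k Hk0), <- INR_IZR_INZ, <- He0.
        rewrite <- (half_periodic_iter e (Z.to_nat k) Hper 0 (Rle_refl 0)). f_equal. ring. }
      assert (Hcos : cos s = 1).
      { pose proof (sin2_cos2 s) as Hsc. unfold Rsqr in Hsc. rewrite Hsin in Hsc.
        assert (0 < cos s) by nra. nra. }
      rewrite Hcos, Rmult_1_r in Ey.
      specialize (Hgap s ltac:(lra)). rewrite Hes', Ey, ln_exp in Hgap. lra. }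
    exists (- t0). intros t.
    assert (Hu := lienard_unique _ _ _ _ t0 H' (lienard_shift X Y (- t0) HXY)).
    cbv beta in Hu. rewrite Rplus_opp_r in Hu. apply Hu; lra.
Qed.

End Lienard.

(** * The hyperbolic tangent *)

Lemma cosh_pos x : 0 < cosh x.
Proof. unfold cosh. pose proof (exp_pos x). pose proof (exp_pos (- x)). lra. Qed.

Lemma tanh_0 : tanh 0 = 0.
Proof. unfold tanh. rewrite sinh_0. unfold Rdiv. ring. Qed.

Lemma tanh_opp x : tanh (- x) = - tanh x.
Proof.
  pose proof (cosh_pos x). unfold tanh, sinh, cosh in *. rewrite Ropp_involutive.
  field. lra.
Qed.

Lemma tanh_derive x : is_derive tanh x (1 - tanh x ^ 2).
Proof.
  pose proof (cosh_pos x). unfold tanh, sinh, cosh in *.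
  auto_derive; [lra |]. field. lra.
Qed.

Lemma tanh_sq_lt1 x : tanh x ^ 2 < 1.
Proof.
  pose proof (cosh_pos x).
  assert (Hx : 1 - tanh x ^ 2 = / cosh x ^ 2).
  { pose proof (exp_pos x). pose proof (exp_pos (- x)).
    assert (He : exp (- x) = / exp x) by apply exp_Ropp.
    unfold tanh, sinh, cosh in *. rewrite He in *. field. split; [lra |].
    assert (0 < exp x * exp x + 1) by nra. simpl in *. nra. }
  assert (0 < / cosh x ^ 2) by (apply Rinv_0_lt_compat, pow_lt; auto). lra.
Qed.

Lemma tanh_bound x : Rabs (tanh x) <= 1.
Proof. pose proof (tanh_sq_lt1 x). apply Rabs_le. nra. Qed.

Lemma tanh_pos x : 0 < x -> 0 < tanh x.
Proof.
  intros Hx. rewrite <- tanh_0.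
  apply (increasing_of_derive tanh (fun x => 1 - tanh x ^ 2)); auto.
  - intros t _. apply tanh_derive.
  - intros t _. pose proof (tanh_sq_lt1 t). lra.
Qed.

Lemma tanh_lt_id x : 0 < x -> tanh x < x.
Proof.
  intros Hx. enough (0 - tanh 0 < x - tanh x) by (rewrite tanh_0 in *; lra).
  apply (increasing_of_derive (fun x => x - tanh x) (fun x => tanh x ^ 2)); auto.
  - intros t _. pose proof (tanh_derive t). derive_from_context. ring.
  - intros t Ht. apply pow_lt, tanh_pos. lra.
Qed.

Lemma tanh_lipschitz x y : Rabs (tanh x - tanh y) <= Rabs (x - y).
Proof.
  assert (H : forall p q, p <= q -> Rabs (tanh q - tanh p) <= Rabs (q - p)).
  { intros p q Hpq. rewrite (Rabs_pos_eq (q - p)), <- (Rmult_1_l (q - p)) by lra.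
    apply (lipschitz_of_derive tanh (fun x => 1 - tanh x ^ 2)); auto.
    - intros t _. apply tanh_derive.
    - intros t _. pose proof (tanh_sq_lt1 t). pose proof (pow2_ge_0 (tanh t)).
      apply Rabs_le. lra. }
  destruct (Rle_lt_dec y x); auto.
  rewrite (Rabs_minus_sym x), (Rabs_minus_sym (tanh x)). apply H. lra.
Qed.

(** Strict concavity of [tanh] on the half line, which makes [tanh x / x] strictly
    decreasing there. *)
Lemma tanh_above_tangent_slope x : 0 < x -> x * (1 - tanh x ^ 2) < tanh x.
Proof.
  intros Hx. enough (tanh 0 - 0 * (1 - tanh 0 ^ 2) < tanh x - x * (1 - tanh x ^ 2))
    by (rewrite tanh_0 in *; lra).
  apply (increasing_of_derive (fun x => tanh x - x * (1 - tanh x ^ 2))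
    (fun x => 2 * x * tanh x * (1 - tanh x ^ 2))); auto.
  - intros t _. pose proof (tanh_derive t). derive_from_context. ring.
  - intros t Ht. pose proof (tanh_sq_lt1 t). pose proof (tanh_pos t ltac:(lra)).
    apply Rmult_lt_0_compat; [| lra]. apply Rmult_lt_0_compat; lra.
Qed.

(** * Trajectories, derivatives and distances *)

(** With [v] the one-sided derivative of [f] at 0, the affine continuation to negative
    times makes the extended function differentiable at 0. *)
Definition extend_left (f : R -> R) (v t : R) : R :=
  if Rle_dec 0 t then f t else f 0 + v * t.

Lemma extend_left_eq f v t : 0 <= t -> extend_left f v t = f t.
Proof. intros Ht. unfold extend_left. destruct (Rle_dec 0 t); [auto | lra]. Qed.

Lemma extend_left_derive (f d : R -> R) :
  (forall t, 0 <= t -> D_in f d (fun t => 0 <= t) t) ->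
  forall t, 0 <= t -> is_derive (extend_left f (d 0)) t (d t).
Proof.
  intros H t Ht. apply is_derive_Reals. intros eps Heps.
  destruct (H t Ht eps Heps) as (al & Hal & Hlim). simpl in Hlim. unfold Rdist, D_x in Hlim.
  assert (Hpos : forall h, h <> 0 -> Rabs h < al -> 0 <= t + h ->
    Rabs ((extend_left f (d 0) (t + h) - extend_left f (d 0) t) / h - d t) < eps).
  { intros h Hh Hlt Hth. rewrite !extend_left_eq by auto.
    specialize (Hlim (t + h)). replace (t + h - t) with h in Hlim by ring.
    apply Hlim. split; [split; [auto | lra] | auto]. }
  destruct Ht as [Ht | <-].
  - assert (Hm : 0 < Rmin al t) by (apply Rmin_glb_lt; lra).
    exists (mkposreal _ Hm). simpl. intros h Hh Hlt.
    assert (H1 := Rlt_le_trans _ _ _ Hlt (Rmin_l _ _)).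
    assert (H2 := Rlt_le_trans _ _ _ Hlt (Rmin_r _ _)). apply Rabs_def2 in H2.
    apply Hpos; auto. lra.
  - exists (mkposreal _ Hal). simpl. intros h Hh Hlt.
    destruct (Rle_lt_dec 0 h) as [Hp | Hn]; [apply Hpos; auto; lra |].
    rewrite Rplus_0_l, (extend_left_eq f _ 0) by lra. unfold extend_left.
    destruct (Rle_dec 0 h); [lra |].
    replace ((f 0 + d 0 * h - f 0) / h - d 0) with 0 by (field; auto).
    rewrite Rabs_R0. auto.
Qed.

Lemma D_in_all (f d : R -> R) t : D_in f d (fun _ => True) t <-> is_derive f t (d t).
Proof.
  split.
  - intros H. apply is_derive_Reals. intros eps Heps.
    destruct (H eps Heps) as (al & Hal & Hlim). exists (mkposreal _ Hal). simpl.
    intros h Hh Hlt. simpl in Hlim. unfold Rdist, D_x in Hlim.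
    specialize (Hlim (t + h)). replace (t + h - t) with h in Hlim by ring.
    apply Hlim. split; [split; [auto | lra] | auto].
  - intros H eps Heps. apply is_derive_Reals in H.
    destruct (H eps Heps) as [al Hlim]. exists al. split; [apply cond_pos |].
    intros s [[_ Hne] Hs]. simpl in *. unfold Rdist in *.
    specialize (Hlim (s - t)). replace (t + (s - t)) with s in Hlim by ring.
    apply Hlim; auto. lra.
Qed.

Lemma dist_to_set_bounds p q (G : R * R -> Prop) : G q ->
  0 <= dist_to_set p G <= dist_euc (fst p) (snd p) (fst q) (snd q).
Proof.
  intros Hq. unfold dist_to_set.
  set (E := fun d => exists q, G q /\ d = dist_euc (fst p) (snd p) (fst q) (snd q)).
  destruct (Glb_Rbar_correct E) as [Hlb Hgr].
  assert (H1 : Rbar_le (Glb_Rbar E) (dist_euc (fst p) (snd p) (fst q) (snd q))).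
  { apply Hlb. exists q. auto. }
  assert (H2 : Rbar_le 0 (Glb_Rbar E)).
  { apply Hgr. intros d (q' & _ & ->). apply sqrt_pos. }
  destruct (Glb_Rbar E); simpl in *; try contradiction. auto.
Qed.

Lemma dist_euc_le x y x' y' : dist_euc x y x' y' <= Rabs (x - x') + Rabs (y - y').
Proof.
  unfold dist_euc. pose proof (Rabs_pos (x - x')). pose proof (Rabs_pos (y - y')).
  rewrite <- (sqrt_Rsqr (Rabs (x - x') + Rabs (y - y'))) by lra.
  apply sqrt_le_1_alt. rewrite (Rsqr_abs (x - x')), (Rsqr_abs (y - y')). unfold Rsqr. nra.
Qed.

(** * The Curie-Weiss system as a Lienard system *)

Section CurieWeiss.

Variables (alpha beta : R).
Hypotheses (Halpha : 0 < alpha) (Hbeta : 0 <= beta).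

Definition global_solution (m l : R -> R) : Prop :=
  forall t, solves m_field (lambda_field alpha beta) m l t.

Lemma fields_lipschitz :
  lipschitz2 (2 + 2 * beta + alpha) m_field /\
  lipschitz2 (2 + 2 * beta + alpha) (lambda_field alpha beta).
Proof.
  split; intros m l m' l'; pose proof (tanh_lipschitz l l');
    pose proof (Rabs_pos (m - m')); pose proof (Rabs_pos (l - l'));
    set (dm := Rabs (m - m')) in *; set (dl := Rabs (l - l')) in *.
  - unfold m_field.
    replace (- 2 * (m + tanh l) - - 2 * (m' + tanh l'))
      with (- (2 * ((m - m') + (tanh l - tanh l')))) by ring.
    rewrite Rabs_Ropp, Rabs_mult, (Rabs_pos_eq 2) by lra.
    pose proof (Rabs_triang (m - m') (tanh l - tanh l')) as Htri. fold dm in Htri.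
    assert (0 <= (2 * beta + alpha) * (dm + dl)) by (apply Rmult_le_pos; lra). lra.
  - unfold lambda_field.
    replace (2 * beta * (m + tanh l) - alpha * l - (2 * beta * (m' + tanh l') - alpha * l'))
      with (2 * beta * ((m - m') + (tanh l - tanh l')) + - (alpha * (l - l'))) by ring.
    eapply Rle_trans; [apply Rabs_triang |].
    rewrite Rabs_Ropp, !Rabs_mult, (Rabs_pos_eq 2), (Rabs_pos_eq beta), (Rabs_pos_eq alpha) by lra.
    pose proof (Rabs_triang (m - m') (tanh l - tanh l')) as Htri. fold dm in Htri.
    fold dl.
    assert (2 * beta * Rabs (m - m' + (tanh l - tanh l')) <= 2 * beta * (dm + dl)).
    { apply Rmult_le_compat_l; lra. }
    assert (0 <= alpha * dm) by (apply Rmult_le_pos; lra). lra.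
Qed.

(** The affine continuation satisfies the equations at all times [t >= 0], so uniqueness
    identifies it there with the solution on the whole line. *)
Lemma trajectory_extends m l : trajectory alpha beta m l ->
  exists m' l', global_solution m' l' /\ forall t, 0 <= t -> m' t = m t /\ l' t = l t.
Proof.
  intros H. destruct fields_lipschitz as [Hm Hl].
  destruct (solution_exists m_field (lambda_field alpha beta) (2 + 2 * beta + alpha)
    (m 0) (l 0) ltac:(lra) Hm Hl) as (m' & l' & Hs & Hm0 & Hl0).
  exists m', l'. split; [exact Hs |].
  set (dm := fun s => m_field (m s) (l s)).
  set (dl := fun s => lambda_field alpha beta (m s) (l s)).
  assert (He : forall t, 0 <= t ->
    solves m_field (lambda_field alpha beta) (extend_left m (dm 0)) (extend_left l (dl 0)) t).
  { intros t Ht. split; rewrite !extend_left_eq by auto.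
    - apply (extend_left_derive m dm); auto. intros s Hst. apply (H s Hst).
    - apply (extend_left_derive l dl); auto. intros s Hst. apply (H s Hst). }
  intros t Ht.
  assert (Hu := solution_unique m_field (lambda_field alpha beta) _ m' l'
    (extend_left m (dm 0)) (extend_left l (dl 0)) 0 t 0 Hm Hl).
  rewrite !(extend_left_eq _ _ 0) in Hu by lra.
  specialize (Hu ltac:(lra) (fun s _ => Hs s) (fun s Hst => He s (proj1 Hst)) Hm0 Hl0 t).
  rewrite !extend_left_eq in Hu by auto. apply Hu. lra.
Qed.

(** The prefix [cw] marks the data of the Lienard system associated with the
    Curie-Weiss system. The factor [cw_freq / alpha] in [lienard_y] equals
    [2 / cw_freq]; it gives the two coupling terms of that system opposite coefficients. *)
Definition cw_freq : R := sqrt (2 * alpha).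
Definition cw_friction (x : R) : R := (alpha + 2) * x - 2 * beta * tanh x.
Definition cw_friction_deriv (x : R) : R := (alpha + 2) - 2 * beta * (1 - tanh x ^ 2).
Definition lienard_y (m l : R) : R := cw_freq / alpha * (l + beta * m).

Lemma cw_freq_pos : 0 < cw_freq.
Proof. apply sqrt_lt_R0. lra. Qed.

Lemma cw_freq_sq : cw_freq * cw_freq = 2 * alpha.
Proof. apply sqrt_sqrt. lra. Qed.

Lemma cw_friction_derive x : is_derive cw_friction x (cw_friction_deriv x).
Proof.
  pose proof (tanh_derive x). unfold cw_friction, cw_friction_deriv.
  derive_from_context. ring.
Qed.

Lemma cw_friction_deriv_continuous x : continuous cw_friction_deriv x.
Proof.
  apply @ex_derive_continuous. pose proof (tanh_derive x). unfold cw_friction_deriv.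
  auto_derive. repeat split; eexists; eassumption.
Qed.

Lemma cw_friction_odd x : cw_friction (- x) = - cw_friction x.
Proof. unfold cw_friction. rewrite tanh_opp. ring. Qed.

Lemma cw_friction_deriv_bound x : Rabs (cw_friction_deriv x) <= alpha + 2 + 2 * beta.
Proof.
  pose proof (tanh_sq_lt1 x). pose proof (pow2_ge_0 (tanh x)). unfold cw_friction_deriv.
  apply Rabs_le. nra.
Qed.

Lemma to_lienard m l : global_solution m l ->
  lienard cw_friction cw_freq l (fun t => lienard_y (m t) (l t)).
Proof.
  intros H t. destruct (H t) as [Hm Hl]. pose proof cw_freq_sq as Hsq. pose proof cw_freq_pos.
  unfold solves, lienard_y, cw_friction, m_field, lambda_field in *. split.
  - evar_last; [exact Hl |].
    replace (cw_freq * (cw_freq / alpha * (l t + beta * m t)))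
      with (cw_freq * cw_freq / alpha * (l t + beta * m t)) by (field; lra).
    rewrite Hsq. field. lra.
  - derive_from_context. field. lra.
Qed.

Lemma zero_iff m l : 0 < beta -> (l, lienard_y m l) = (0, 0) <-> (m, l) = (0, 0).
Proof.
  intros Hb. pose proof cw_freq_pos. unfold lienard_y. split; intros Heq; injection Heq as H1 H2.
  - rewrite H1 in *. f_equal.
    apply (Rmult_eq_reg_l (cw_freq / alpha * beta)); [lra |].
    apply Rgt_not_eq, Rmult_lt_0_compat; auto. apply Rdiv_lt_0_compat; auto.
  - rewrite H1, H2. f_equal. ring.
Qed.

(** * The damped regime *)

Section Damped.

Hypothesis Hsmall : beta <= alpha / 2 + 1.

Lemma cw_friction_monotone x y : x <= y -> cw_friction x <= cw_friction y.
Proof.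
  intros Hxy. apply (nondecreasing_of_derive cw_friction cw_friction_deriv); auto.
  - intros t _. apply cw_friction_derive.
  - intros t _. unfold cw_friction_deriv.
    pose proof (tanh_sq_lt1 t). pose proof (pow2_ge_0 (tanh t)). nra.
Qed.

Lemma cw_friction_pos x : 0 < x -> 0 < cw_friction x.
Proof.
  intros Hx. unfold cw_friction. pose proof (tanh_pos x Hx). pose proof (tanh_lt_id x Hx). nra.
Qed.

(** [- 2 x F x] is the rate at which friction changes the energy; outside [|x| < e] the
    loss is bounded away from 0. *)
Lemma cw_power_lower x e : 0 < e -> e <= Rabs x -> e * cw_friction e <= x * cw_friction x.
Proof.
  intros He Hx. assert (Hp := cw_friction_pos e He).
  assert (H : forall z, e <= z -> e * cw_friction e <= z * cw_friction z).
  { intros z Hz. pose proof (cw_friction_monotone e z Hz). nra. }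
  destruct (Rle_lt_dec 0 x).
  - rewrite Rabs_pos_eq in Hx by auto. auto.
  - rewrite Rabs_left in Hx by auto. specialize (H (- x) Hx). rewrite cw_friction_odd in H. lra.
Qed.

Lemma cw_power_nonneg x : 0 <= x * cw_friction x.
Proof.
  destruct (Req_dec x 0) as [-> | Hx]; [lra |].
  assert (Hp := Rabs_pos_lt x Hx). assert (H := cw_power_lower x (Rabs x) Hp (Rle_refl _)).
  pose proof (cw_friction_pos _ Hp). nra.
Qed.

(** The energy decreases to a limit and its second derivative is bounded, so its
    derivative [- 2 lambda F (lambda)] tends to 0 by Barbalat's lemma. *)
Lemma lambda_tends_to_0 m l : global_solution m l -> is_lim l p_infty 0.
Proof.
  intros H. assert (Hl := to_lienard m l H). set (y := fun t => lienard_y (m t) (l t)) in *.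
  pose proof cw_freq_pos.
  assert (HE : forall t,
    is_derive (fun t => l t ^ 2 + y t ^ 2) t (- (2 * (l t * cw_friction (l t))))).
  { intros t. apply (energy_derive cw_friction cw_freq); auto. }
  assert (Hmon : forall s t, s <= t -> l t ^ 2 + y t ^ 2 <= l s ^ 2 + y s ^ 2).
  { intros s t Hst. apply (nonincreasing_of_derive (fun t => l t ^ 2 + y t ^ 2)
      (fun t => - (2 * (l t * cw_friction (l t))))); auto.
    intros u _. pose proof (cw_power_nonneg (l u)). lra. }
  set (M := l 0 ^ 2 + y 0 ^ 2) in *.
  set (K := 1 + M).
  assert (HK : forall t, 0 <= t -> Rabs (l t) <= K /\ Rabs (y t) <= K).
  { intros t Ht. specialize (Hmon 0 t Ht). fold M in Hmon. unfold K.
    pose proof (Rabs_le_1_plus_sq (l t)). pose proof (Rabs_le_1_plus_sq (y t)).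
    pose proof (pow2_ge_0 (l t)). pose proof (pow2_ge_0 (y t)). lra. }
  destruct (nonincreasing_bounded_lim (fun t => l t ^ 2 + y t ^ 2) 0) as [V HV].
  { intros s t _ Hst. auto. }
  { intros t _. pose proof (pow2_ge_0 (l t)). pose proof (pow2_ge_0 (y t)). lra. }
  set (L := alpha + 2 + 2 * beta).
  assert (HFl : forall x, Rabs (cw_friction x) <= L * Rabs x).
  { intros x. apply (friction_linear_bound cw_friction cw_friction_deriv);
      auto using cw_friction_derive, cw_friction_odd, cw_friction_deriv_bound. }
  assert (Hb : is_lim (fun t => - (2 * (l t * cw_friction (l t)))) p_infty 0).
  { apply (barbalat (fun t => l t ^ 2 + y t ^ 2) _
      (fun t => - (2 * ((cw_friction (l t) + l t * cw_friction_deriv (l t))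
        * (cw_freq * y t - cw_friction (l t))))) V
      (2 * ((L * K + K * L) * (cw_freq * K + L * K)))); auto.
    - intros t _. destruct (Hl t) as [H1 _].
      assert (H3 : is_derive (fun t => cw_friction (l t)) t
        ((cw_freq * y t - cw_friction (l t)) * cw_friction_deriv (l t))).
      { apply (is_derive_comp cw_friction l); auto. apply cw_friction_derive. }
      set (g := fun t => cw_friction (l t)) in *.
      apply (is_derive_ext (fun t => - (2 * (l t * g t)))); [reflexivity |].
      derive_from_context. unfold g. ring.
    - intros t Ht. destruct (HK t Ht) as [HK1 HK2].
      rewrite Rabs_Ropp, Rabs_mult, (Rabs_pos_eq 2), Rabs_mult by lra.
      apply Rmult_le_compat_l; [lra |].
      pose proof (HFl (l t)). pose proof (cw_friction_deriv_bound (l t)) as HF1. fold L in HF1.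
      assert (HL : 0 <= L) by (unfold L; lra).
      assert (HFK : Rabs (cw_friction (l t)) <= L * K).
      { eapply Rle_trans; [apply HFl |]. apply Rmult_le_compat_l; auto. }
      apply Rmult_le_compat; try apply Rabs_pos.
      + eapply Rle_trans; [apply Rabs_triang |]. rewrite Rabs_mult.
        apply Rplus_le_compat; auto. apply Rmult_le_compat; auto using Rabs_pos.
      + eapply Rle_trans; [apply Rabs_triang |].
        rewrite Rabs_Ropp, Rabs_mult, (Rabs_pos_eq cw_freq) by lra.
        apply Rplus_le_compat; auto. apply Rmult_le_compat_l; lra. }
  apply is_lim_p_infty_eps; intros eps Heps.
  assert (Hpe := cw_friction_pos eps Heps).
  destruct (proj1 (is_lim_p_infty_eps _ _) Hb (2 * (eps * cw_friction eps))) as [T HT]; [nra |].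
  exists T. intros t Ht. rewrite Rminus_0_r. specialize (HT t Ht).
  apply Rnot_le_lt; intros Hle. assert (Hx := cw_power_lower (l t) eps Heps Hle).
  rewrite Rminus_0_r, Rabs_Ropp in HT. pose proof (Rle_abs (2 * (l t * cw_friction (l t)))). lra.
Qed.

Lemma damped_global_attractor : origin_global_attractor alpha beta.
Proof.
  intros m l H. destruct (trajectory_extends m l H) as (m' & l' & Hs & Heq).
  assert (Hl := lambda_tends_to_0 m' l' Hs).
  assert (Hm : is_lim m' p_infty 0).
  { apply (damped_lim m' (fun t => - (2 * tanh (l' t))) 2); [lra | |].
    - intros t _. destruct (Hs t) as [H1 _]. evar_last; [exact H1 |]. unfold m_field. ring.
    - apply is_lim_p_infty_eps; intros eps Heps.
      destruct (proj1 (is_lim_p_infty_eps _ _) Hl (eps / 2)) as [T HT]; [lra |].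
      exists T. intros t Ht. specialize (HT t Ht). rewrite Rminus_0_r in *.
      rewrite Rabs_Ropp, Rabs_mult, (Rabs_pos_eq 2) by lra.
      pose proof (tanh_lipschitz (l' t) 0). rewrite tanh_0, !Rminus_0_r in *. lra. }
  split; [apply (is_lim_ext_loc m') | apply (is_lim_ext_loc l')]; auto;
    exists 0; intros t Ht; apply Heq; lra.
Qed.

End Damped.

(** * The oscillating regime *)

Section Oscillating.

Hypothesis Hlarge : beta > alpha / 2 + 1.

(** [tanh x >= x (1 - tanh^2 x) >= x (1 - x^2)] for [x >= 0], so the friction is at most
    [x (alpha + 2 - 2 beta (1 - x^2))] there, which is not positive up to this amplitude. *)
Definition small_amplitude : R := sqrt ((2 * beta - alpha - 2) / (2 * beta)).

Lemma small_amplitude_pos : 0 < small_amplitude.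
Proof. apply sqrt_lt_R0, Rdiv_lt_0_compat; lra. Qed.

Lemma cw_friction_ratio x : 0 < x -> cw_friction x < x * cw_friction_deriv x.
Proof.
  intros Hx. unfold cw_friction, cw_friction_deriv. pose proof (tanh_above_tangent_slope x Hx). nra.
Qed.

Lemma cw_power_nonpos x : Rabs x <= small_amplitude -> x * cw_friction x <= 0.
Proof.
  assert (H : forall z, 0 < z -> z <= small_amplitude -> cw_friction z <= 0).
  { intros z Hz Hza. pose proof (tanh_above_tangent_slope z Hz).
    pose proof (tanh_pos z Hz). pose proof (tanh_lt_id z Hz).
    assert (Hz2 : z * z * (2 * beta) <= 2 * beta - alpha - 2).
    { assert (Hs : small_amplitude * small_amplitude = (2 * beta - alpha - 2) / (2 * beta)).
      { apply sqrt_sqrt. left. apply Rdiv_lt_0_compat; lra. }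
      assert (Hzz : z * z <= (2 * beta - alpha - 2) / (2 * beta)) by (rewrite <- Hs; nra).
      apply (Rmult_le_compat_r (2 * beta)) in Hzz; [| lra].
      replace ((2 * beta - alpha - 2) / (2 * beta) * (2 * beta))
        with (2 * beta - alpha - 2) in Hzz by (field; lra).
      exact Hzz. }
    assert (Htz : tanh z ^ 2 <= z * z) by (simpl; nra).
    apply (Rmult_le_compat_l z) in Htz; [| lra].
    assert (Ht : z * (1 - z * z) <= tanh z) by lra.
    apply (Rmult_le_compat_l (2 * beta)) in Ht; [| lra].
    apply (Rmult_le_compat_l z) in Hz2; [| lra].
    unfold cw_friction. lra. }
  intros Hx. destruct (Rtotal_order x 0) as [Hn | [-> | Hp]]; [| lra |].
  - rewrite Rabs_left in Hx by auto. specialize (H (- x) ltac:(lra) Hx).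
    rewrite cw_friction_odd in H. nra.
  - rewrite Rabs_pos_eq in Hx by lra. specialize (H x Hp Hx). nra.
Qed.

Definition recover_m (x y : R) : R := (alpha / cw_freq * y - x) / beta.

Lemma recover_m_lienard_y m l : recover_m l (lienard_y m l) = m.
Proof. unfold recover_m, lienard_y. pose proof cw_freq_pos. field. lra. Qed.

Lemma of_lienard x y : lienard cw_friction cw_freq x y ->
  global_solution (fun t => recover_m (x t) (y t)) x.
Proof.
  intros H t. destruct (H t) as [Hx Hy]. pose proof cw_freq_sq as Hsq. pose proof cw_freq_pos.
  assert (Hs : alpha / cw_freq = cw_freq / 2).
  { apply (Rmult_eq_reg_r (2 * cw_freq)); [| lra]. field_simplify; lra. }
  unfold recover_m, solves, cw_friction, m_field, lambda_field in *. rewrite Hs. split.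
  - derive_from_context.
    replace alpha with (cw_freq * cw_freq / 2) by lra. field. lra.
  - evar_last; [exact Hx |]. field. lra.
Qed.

(** In the original variables boundedness is immediate: [m] is damped and driven by the
    bounded [tanh lambda], and [lambda] is damped and driven by [m] and [tanh lambda]. *)
Lemma lienard_bounded x y : lienard cw_friction cw_freq x y ->
  exists M, forall t, 0 <= t -> x t ^ 2 + y t ^ 2 <= M.
Proof.
  intros H. assert (Hs := of_lienard x y H). set (m := fun t => recover_m (x t) (y t)) in *.
  pose proof cw_freq_pos.
  assert (Hexp : forall c t, 0 < c -> 0 <= t -> exp (- c * (t - 0)) <= 1).
  { intros c t Hc Ht. rewrite <- exp_0.
    destruct (Rle_lt_or_eq_dec 0 t Ht) as [Hlt | <-].
    - left. apply exp_increasing. nra.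
    - right. f_equal. ring. }
  set (Bm := Rabs (m 0) + 1).
  assert (Hm : forall t, 0 <= t -> Rabs (m t) <= Bm).
  { intros t Ht. unfold Bm.
    assert (Hdb := damped_bound m (fun s => - (2 * tanh (x s))) 2 2 0 t ltac:(lra) Ht).
    specialize (Hexp 2 t ltac:(lra) Ht). pose proof (Rabs_pos (m 0)).
    eapply Rle_trans; [apply Hdb |].
    - intros s _. destruct (Hs s) as [Hd _]. evar_last; [exact Hd |]. unfold m_field. ring.
    - intros s _. rewrite Rabs_Ropp, Rabs_mult, (Rabs_pos_eq 2) by lra.
      pose proof (tanh_bound (x s)). lra.
    - replace (2 / 2) with 1 by field. nra. }
  set (B := 2 * beta * (Bm + 1)).
  set (Bx := Rabs (x 0) + B / alpha).
  assert (Hx : forall t, 0 <= t -> Rabs (x t) <= Bx).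
  { intros t Ht. unfold Bx.
    assert (Hdb := damped_bound x (fun s => 2 * beta * (m s + tanh (x s)))
      alpha B 0 t Halpha Ht).
    specialize (Hexp alpha t Halpha Ht). pose proof (Rabs_pos (x 0)).
    eapply Rle_trans; [apply Hdb |].
    - intros s _. exact (proj2 (Hs s)).
    - intros s Hs0. rewrite !Rabs_mult, (Rabs_pos_eq 2), (Rabs_pos_eq beta) by lra.
      pose proof (Rabs_triang (m s) (tanh (x s))). pose proof (tanh_bound (x s)).
      specialize (Hm s Hs0). apply Rmult_le_compat_l; lra.
    - apply Rplus_le_compat_r. nra. }
  exists (Bx ^ 2 + (cw_freq / alpha * (Bx + beta * Bm)) ^ 2). intros t Ht.
  specialize (Hm t Ht). specialize (Hx t Ht).
  assert (Hy : y t = cw_freq / alpha * (x t + beta * m t)).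
  { unfold m, recover_m. field. lra. }
  assert (Hya : Rabs (y t) <= cw_freq / alpha * (Bx + beta * Bm)).
  { assert (0 < cw_freq / alpha) by (apply Rdiv_lt_0_compat; lra).
    rewrite Hy, Rabs_mult, (Rabs_pos_eq (cw_freq / alpha)) by lra.
    apply Rmult_le_compat_l; [lra |].
    eapply Rle_trans; [apply Rabs_triang |]. rewrite Rabs_mult, (Rabs_pos_eq beta) by lra.
    assert (beta * Rabs (m t) <= beta * Bm) by (apply Rmult_le_compat_l; lra). lra. }
  rewrite <- (pow2_abs (x t)), <- (pow2_abs (y t)).
  apply Rplus_le_compat; apply pow_incr; split; auto using Rabs_pos.
Qed.

Lemma oscillating_limit_cycle :
  exists G : R * R -> Prop,
    periodic_orbit alpha beta G /\
    (forall G' : R * R -> Prop, periodic_orbit alpha beta G' ->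
      forall p : R * R, G' p <-> G p) /\
    (forall m lambda : R -> R,
      trajectory alpha beta m lambda ->
      ~ (forall t : R, 0 <= t -> (m t, lambda t) = (0, 0)) ->
      attracts G m lambda).
Proof.
  assert (Hb : 0 < beta) by lra. pose proof cw_freq_pos.
  destruct (lienard_limit_cycle cw_friction cw_friction_deriv cw_freq
    (alpha + 2 + 2 * beta) small_amplitude)
    as (X & Y & T & HXY & HT & HY0 & Hhalf & Hatt & Huniq);
    auto using cw_freq_pos, cw_friction_derive, cw_friction_deriv_continuous, cw_friction_odd,
      cw_friction_deriv_bound, cw_friction_ratio,
      small_amplitude_pos, cw_power_nonpos, lienard_bounded.
  set (mG := fun t => recover_m (X t) (Y t)).
  assert (HG := of_lienard X Y HXY). fold mG in HG.
  exists (fun p => exists t, p = (mG t, X t)). split; [| split].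
  - exists mG, X. split; [split |].
    + intros t _. destruct (HG t) as [H1 H2]. split; apply D_in_all; auto.
    + exists (2 * T). split; [lra |]. intros t.
      destruct (Hhalf t) as [E1 E2]. destruct (Hhalf (t + T)) as [E3 E4].
      replace (t + 2 * T) with (t + T + T) by ring.
      unfold mG. rewrite E3, E4, E1, E2, !Ropp_involutive. auto.
    + split.
      * exists 0, T. intros Heq. injection Heq as E1 E2.
        destruct (Hhalf 0) as [E3 E4]. rewrite Rplus_0_l in E3, E4.
        unfold mG, recover_m in E1. rewrite E3, E4 in *.
        assert (HX : X 0 = 0) by lra. rewrite HX in E1.
        assert (Hc : 0 < alpha / cw_freq / beta * Y 0).
        { repeat apply Rmult_lt_0_compat; auto; apply Rinv_0_lt_compat; auto. }
        unfold Rdiv in *. lra.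
      * reflexivity.
  - intros G' (m & l & [Hsol (P & HP & Hper)] & (s1 & s2 & Hnc) & HG') p.
    assert (Hs : global_solution m l).
    { intros t. destruct (Hsol t I) as [H1 H2].
      apply (D_in_all l (fun s => lambda_field alpha beta (m s) (l s))) in H1.
      apply (D_in_all m (fun s => m_field (m s) (l s))) in H2. split; auto. }
    destruct (Huniq l (fun t => lienard_y (m t) (l t)) P) as [c Hc]; auto.
    + apply to_lienard; auto.
    + intros Hz.
      assert (Hall : forall t, (m t, l t) = (0, 0)).
      { intros t. apply zero_iff; auto.
        injection Hz as Hz1 Hz2.
        destruct (lienard_unique cw_friction cw_friction_deriv cw_freq (alpha + 2 + 2 * beta)
          cw_freq_pos cw_friction_derive cw_friction_deriv_bound _ _ _ _ 0 (to_lienard m l Hs)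
          (lienard_zero cw_friction cw_freq cw_friction_odd) Hz1 Hz2 t) as [-> ->]. auto. }
      apply Hnc. rewrite !Hall. auto.
    + intros t. destruct (Hper t) as [-> ->]. auto.
    + assert (Hm : forall t, m t = mG (t + c)).
      { intros t. destruct (Hc t) as [E1 E2]. unfold mG. rewrite <- E1, <- E2.
        symmetry. apply recover_m_lienard_y. }
      rewrite HG'. split; intros [t ->].
      * exists (t + c). rewrite Hm. f_equal. apply Hc.
      * exists (t - c). rewrite Hm. destruct (Hc (t - c)) as [-> _].
        replace (t - c + c) with t by ring. auto.
  - intros m l Htr Hnz. destruct (trajectory_extends m l Htr) as (m' & l' & Hs & Heq).
    assert (Hlie := to_lienard m' l' Hs).
    assert (Hnz0 : (l' 0, lienard_y (m' 0) (l' 0)) <> (0, 0)).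
    { intros Hz. apply Hnz. intros t Ht. destruct (Heq t Ht) as [<- <-].
      apply zero_iff; auto. injection Hz as Hz1 Hz2.
      destruct (lienard_unique cw_friction cw_friction_deriv cw_freq (alpha + 2 + 2 * beta)
        cw_freq_pos cw_friction_derive cw_friction_deriv_bound _ _ _ _ 0 Hlie
        (lienard_zero cw_friction cw_freq cw_friction_odd) Hz1 Hz2 t) as [-> ->]. auto. }
    apply is_lim_p_infty_eps; intros eps Heps.
    set (c := (alpha / cw_freq + 1) / beta + 1).
    assert (Hao : 0 < alpha / cw_freq) by (apply Rdiv_lt_0_compat; auto).
    assert (Hcp : 0 < (alpha / cw_freq + 1) / beta) by (apply Rdiv_lt_0_compat; lra).
    destruct (Hatt _ _ Hlie Hnz0 (eps / c)) as [T0 HT0].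
    { apply Rdiv_lt_0_compat; unfold c; lra. }
    exists (Rmax T0 0). intros t Ht.
    assert (T0 < t) by (pose proof (Rmax_l T0 0); lra).
    assert (0 <= t) by (pose proof (Rmax_r T0 0); lra).
    destruct (HT0 t ltac:(auto)) as (s & Hx & Hy).
    destruct (Heq t ltac:(auto)) as [Em El].
    rewrite <- Em, <- El, Rminus_0_r.
    set (e := eps / c) in *.
    assert (Hce : c * e = eps) by (unfold e; field; unfold c; lra).
    assert (Hd := dist_to_set_bounds (m' t, l' t) (mG s, X s)
      (fun p => exists t, p = (mG t, X t)) (ex_intro _ s eq_refl)).
    simpl fst in Hd. simpl snd in Hd.
    pose proof (dist_euc_le (m' t) (l' t) (mG s) (X s)).
    assert (Hmd : Rabs (m' t - mG s) <= (alpha / cw_freq + 1) / beta * e).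
    { rewrite <- (recover_m_lienard_y (m' t) (l' t)) at 1. unfold mG, recover_m.
      set (yt := lienard_y (m' t) (l' t)) in *.
      replace ((alpha / cw_freq * yt - l' t) / beta - (alpha / cw_freq * Y s - X s) / beta)
        with (/ beta * (alpha / cw_freq * (yt - Y s) - (l' t - X s))) by (field; lra).
      rewrite Rabs_mult, (Rabs_pos_eq (/ beta)) by (left; apply Rinv_0_lt_compat; auto).
      unfold Rdiv at 2. rewrite (Rmult_comm _ (/ beta)), Rmult_assoc.
      apply Rmult_le_compat_l; [left; apply Rinv_0_lt_compat; auto |].
      eapply Rle_trans; [apply Rabs_triang |].
      rewrite Rabs_Ropp, Rabs_mult, (Rabs_pos_eq (alpha / cw_freq)) by lra.
      assert (alpha / cw_freq * Rabs (yt - Y s) <= alpha / cw_freq * e)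
        by (apply Rmult_le_compat_l; lra). lra. }
    rewrite Rabs_pos_eq by lra. unfold c in Hce. lra.
Qed.

End Oscillating.

End CurieWeiss.

Theorem theorem3p1 (alpha beta : R) (Halpha : 0 < alpha) (Hbeta : 0 <= beta) :
  (beta <= alpha / 2 + 1 -> origin_global_attractor alpha beta) /\
  (beta > alpha / 2 + 1 ->
    exists G : R * R -> Prop,
      periodic_orbit alpha beta G /\
      (forall G' : R * R -> Prop, periodic_orbit alpha beta G' ->
        forall p : R * R, G' p <-> G p) /\
      (forall m lambda : R -> R,
        trajectory alpha beta m lambda ->
        ~ (forall t : R, 0 <= t -> (m t, lambda t) = (0, 0)) ->
        attracts G m lambda)).
Proof.
  split.
  - apply damped_global_attractor; assumption.
  - apply oscillating_limit_cycle; assumption.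
Qed.
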